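(* Let $M$ be a compact connected manifold and let $f:M\to M$ be a partially hyperbolic diffeomorphism. If the center foliation $W^c$ exists and is without holonomy, and $f$ has Global Product Structure, then all leaves of $W^c$ on $M$ are homeomorphic to each other.
   Context: Manifolds are without boundary and Riemannian. A $C^1$ diffeomorphism $f:M\to M$ of a compact Riemannian manifold is partially hyperbolic if there are a continuous $Tf$-invariant splitting $TM=E^s\oplus E^c\oplus E^u$, an integer $n\ge 1$ and constants $0<\lambda<\hat\gamma<1<\gamma<\mu$ such that $\|Tf^nv^s\|<\lambda<\hat\gamma<\|Tf^nv^c\|<\gamma<\mu<\|Tf^nv^u\|$ for all $x\in M$ and all unit vectors $v^s\in E^s(x)$, $v^c\in E^c(x)$, $v^u\in E^u(x)$. Here $E^c\neq 0$ and $E^c\ne TM$; one of $E^s$, $E^u$ is allowed to be the zero bundle (in which case the leaves of its foliation are points). There are always unique foliations $W^s,W^u$ tangent to $E^s,E^u$. A subbundle $E$ is uniquely integrable if there is a foliation $\mathcal F$ with $T\mathcal F=E$ such that every curve tangent to $E$ lies in a single leaf of $\mathcal F$. $f$ is dynamically coherent if $E^c$, $E^{cs}=E^c\oplus E^s$ and $E^{cu}=E^c\oplus E^u$ are uniquely integrable; then $W^c$, $W^{cs}$, $W^{cu}$ denote the corresponding foliations. Leaves carry their intrinsic leaf topology. $f$ has Global Product Structure if it is dynamically coherent (so that the foliations below are defined) and, for the lifts of the foliations to the universal cover $\tilde M$ (denoted by the same symbols) and every $x,y\in\tilde M$: (1) $W^u(x)$ and $W^{cs}(y)$ intersect exactly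 once; (2) $W^s(x)$ and $W^{cu}(y)$ intersect exactly once; (3) if $x\in W^{cs}(y)$, then $W^c(x)$ and $W^s(y)$ intersect exactly once; (4) if $x\in W^{cu}(y)$, then $W^c(x)$ and $W^u(y)$ intersect exactly once. Holonomy: let $\mathcal F$ be a foliation on $M$, $\alpha$ a closed curve on a leaf of $\mathcal F$, and $\tau\subset M$ a small plaque transverse to $\mathcal F$ passing through a point $x$ on $\alpha$, with $\dim\mathcal F+\dim\tau=\dim M$. Then there is a small neighbourhood $\tau_0\subset\tau$ of $x$ and a map $h:\tau_0\to\tau$ defined by following leaves of $\mathcal F$ along paths close to $\alpha$; the germ of $h$ at $x$ is the holonomy along $\alpha$. $\mathcal F$ is without holonomy if every such holonomy germ is the germ of the identity. *)

(* Defs.v *)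
From HB Require Import structures.
From mathcomp Require Import all_boot all_order all_algebra.
From mathcomp Require Import all_classical all_reals all_analysis.

Set Implicit Arguments.
Unset Strict Implicit.
Unset Printing Implicit Defensive.

Import Order.TTheory GRing.Theory Num.Theory.
Import numFieldNormedType.Exports.
Local Open Scope classical_set_scope.
Local Open Scope ring_scope.

Section Ck.
Context {R : realType} {V W : normedModType R}.

Fixpoint Ck_on (k : nat) (U : set V) (F : V -> W) : Prop :=
  if k is k'.+1 then
    (forall x, U x -> differentiable F x) /\
    (forall v, Ck_on k' U (fun x => 'D_v F x))
  else forall x, U x -> {for x, continuous F}.

Definition smooth_on (U : set V) (F : V -> W) := forall k, Ck_on k U F.

Definition C1_at (x : V) (F : V -> W) :=
  exists2 U, open_nbhs x U & Ck_on 1 U F.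

End Ck.

Definition homeo_on {X Y : topologicalType} (A : set X) (B : set Y)
    (h : X -> Y) (g : Y -> X) :=
  [/\ {within A, continuous h}, {within B, continuous g},
      h @` A `<=` B, g @` B `<=` A &
      (forall x, A x -> g (h x) = x) /\ (forall y, B y -> h (g y) = y)].

Record pchart (X V : topologicalType) := Pchart {
  cmap :> X -> V ;
  cinv : V -> X ;
  cdom : set X ;
  cimg : set V ;
  cdom_open : open cdom ;
  cimg_open : open cimg ;
  chart_homeo : homeo_on cdom cimg cmap cinv }.

(* A smooth structure is given by an atlas indexed by the points of M, the chart
   of index x being defined at x; it serves below to identify the tangent space
   at x with 'rV[R]_d. *)
Record manifold (R : realType) (d : nat) := Manifold {
  mpoint :> topologicalType ;
  mhausdorff : hausdorff_space mpoint ;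
  msecond_countable : @second_countable mpoint ;
  chart : mpoint -> pchart mpoint 'rV[R]_d ;
  chart_dom : forall x, cdom (chart x) x ;
  chart_smooth : forall x y,
    smooth_on [set v | cimg (chart x) v /\ cdom (chart y) (cinv (chart x) v)]
      (chart y \o cinv (chart x)) }.

Section Tangent.
Context {R : realType} {d : nat} {M : manifold R d}.
Implicit Types (f : M -> M) (x y : M) (E : M -> {vspace 'rV[R]_d}).

(* A tangent vector at x is a v : 'rV[R]_d, read in the chart of index x. *)

(* The coordinates in the chart of index x of a tangent vector at y, for y in the
   domain of this chart. *)
Definition tcoord x y : 'rV[R]_d -> 'rV[R]_d :=
  'd (chart x \o cinv (chart y)) (chart y y).

Definition tmap f x : 'rV[R]_d -> 'rV[R]_d :=
  'd (chart (f x) \o f \o cinv (chart x)) (chart x x).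

Definition C1_map f :=
  continuous f /\
  forall x, C1_at (chart x x) (chart (f x) \o f \o cinv (chart x)).

Definition C1_diffeo f :=
  C1_map f /\ exists g, [/\ cancel f g, cancel g f & C1_map g].

Definition continuous_subbundle (r : nat) E :=
  forall x, exists e : 'I_r -> M -> 'rV[R]_d,
    \forall y \near x,
      basis_of (E y) [tuple e i y | i < r] /\
      forall i, {for y, continuous (fun z => tcoord x z (e i z))}.

Definition tangent_curve E (a b : R) (c : R -> M) :=
  forall t, a < t < b ->
    [/\ {for t, continuous c},
        C1_at t (chart (c t) \o c) &
        'D_1 (chart (c t) \o c) t \in E (c t)].

End Tangent.

Record riemannian (R : realType) (d : nat) (M : manifold R d) := Riemannian {
  rdot : M -> 'rV[R]_d -> 'rV[R]_d -> R ;
  rdot_linear : forall x w a u v,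
    rdot x (a *: u + v) w = a * rdot x u w + rdot x v w ;
  rdot_sym : forall x u v, rdot x u v = rdot x v u ;
  rdot_pos : forall x v, v != 0 -> 0 < rdot x v v ;
  rdot_smooth : forall x u v,
    smooth_on (cimg (chart x)) (fun w : 'rV[R]_d =>
      let y := cinv (chart x) w in
      let lift := 'd (chart y \o cinv (chart x)) w in
      rdot y (lift u) (lift v)) }.

Definition rnorm {R : realType} {d : nat} {M : manifold R d}
  (g : riemannian M) (x : M) (v : 'rV[R]_d) : R := Num.sqrt (rdot g x v v).

Section PartialHyperbolicity.
Context {R : realType} {d : nat} {M : manifold R d}.
Variables (g : riemannian M) (f : M -> M) (s c u : nat).
Variables (Es Ec Eu : M -> {vspace 'rV[R]_d}).

Definition splitting :=
  [/\ continuous_subbundle s Es, continuous_subbundle c Ec,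
      continuous_subbundle u Eu &
      forall x, directv (Es x + Ec x + Eu x) /\
                (Es x + Ec x + Eu x)%VS = fullv].

Definition invariant_bundle (E : M -> {vspace 'rV[R]_d}) :=
  forall x, tmap f x @` [set` E x] = [set` E (f x)].

Definition partially_hyperbolic :=
  [/\ C1_diffeo f,
      splitting,
      (0 < c < d)%N,
      [/\ invariant_bundle Es, invariant_bundle Ec & invariant_bundle Eu] &
      exists n : nat, (0 < n)%N /\
      exists la ga' ga mu : R,
        [/\ 0 < la, la < ga', ga' < 1, 1 < ga & ga < mu] /\
        forall x,
        [/\ forall v, v \in Es x -> rnorm g x v = 1 ->
              rnorm g (iter n f x) (tmap (iter n f) x v) < la,
            forall v, v \in Ec x -> rnorm g x v = 1 ->
              ga' < rnorm g (iter n f x) (tmap (iter n f) x v) < ga &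
            forall v, v \in Eu x -> rnorm g x v = 1 ->
              mu < rnorm g (iter n f x) (tmap (iter n f) x v)]].

End PartialHyperbolicity.

(* A (topological) foliation with leaves of dimension k and codimension q, given
   by a foliated atlas: the charts map onto the open cube ]-1, 1[^k x ]-1, 1[^q,
   the plaques are the slices where the second component is constant, and
   changes of charts locally preserve plaques. *)
Record foliation (R : realType) (k q : nat) (X : topologicalType) := Foliation {
  fcharts : set (pchart X ('rV[R]_k * 'rV[R]_q)%type) ;
  fcharts_cube : forall psi, fcharts psi -> cimg psi = ball 0 1 ;
  fcharts_cover : forall x, exists2 psi, fcharts psi & cdom psi x ;
  fcharts_compat : forall psi1 psi2 x, fcharts psi1 -> fcharts psi2 ->
    cdom psi1 x -> cdom psi2 x ->
    exists2 U, nbhs x U & forall y z, U y -> U z ->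
      ((psi1 y).2 = (psi1 z).2 <-> (psi2 y).2 = (psi2 z).2) }.

(* X with its leaf topology, generated by the open subsets of plaques; its path
   components, with the induced topology, are the leaves. *)
Definition leaf_space {R : realType} {k q : nat} {X : topologicalType}
  (F : foliation R k q X) : Type := X.

Section LeafTopology.
Context {R : realType} {k q : nat} {X : topologicalType}.
Variable F : foliation R k q X.

HB.instance Definition _ := Choice.copy (leaf_space F) X.

Definition leaf_open (A : set (leaf_space F)) :=
  forall x : X, A x -> forall psi, fcharts F psi -> cdom psi x ->
    \forall y \near x, (psi y).2 = (psi x).2 -> A y.

Lemma leaf_openT : leaf_open setT.
Proof. by move=> x _ psi _ _; apply: nearW. Qed.

Lemma leaf_openI : setI_closed leaf_open.
Proof.
move=> A B oA oB x [Ax Bx] psi Fpsi psix.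
apply: filterS2 (oA x Ax psi Fpsi psix) (oB x Bx psi Fpsi psix).
by move=> y yA yB e; split; [apply: yA|apply: yB].
Qed.

Lemma leaf_open_bigU (I : Type) (A : I -> set (leaf_space F)) :
  (forall i, leaf_open (A i)) -> leaf_open (\bigcup_i A i).
Proof.
move=> oA x [i _ Ax] psi Fpsi psix.
by apply: filterS (oA i x Ax psi Fpsi psix) => y yA e; exists i => //; apply: yA.
Qed.

HB.instance Definition _ := isOpenTopological.Build (leaf_space F)
  leaf_openT leaf_openI leaf_open_bigU.

Definition leafwise_path (c : R -> X) :=
  {within `[0, 1], continuous (c : R -> leaf_space F)}.

Definition leaf (x : X) : set X :=
  [set y | exists c : R -> X, [/\ leafwise_path c, c 0 = x & c 1 = y]].

(* the leaf through x of the lift of F by p *)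
Definition lifted_leaf {Y : topologicalType} (p : Y -> X) (x : Y) : set Y :=
  [set y | exists c : R -> Y,
    [/\ {within `[0, 1], continuous c}, leafwise_path (p \o c),
        c 0 = x & c 1 = y]].

Definition homeomorphic_leaves (x y : X) :=
  exists h g : leaf_space F -> leaf_space F,
    homeo_on (leaf x : set (leaf_space F)) (leaf y : set (leaf_space F)) h g.

(* tau is a topological submanifold of dimension q, contained in the domain of a
   chart of F, and meeting each plaque of this chart in at most one point *)
Definition small_transversal (x : X) (tau : set X) :=
  tau x /\
  exists2 psi, fcharts F psi & tau `<=` cdom psi /\
  exists (B : set 'rV[R]_q) (sigma : 'rV[R]_q -> X),
    open B /\ homeo_on tau B (fun y => (psi y).2) sigma.

(* h, defined on the part of tau in U, follows leaves along the paths H (y, -),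
   which are close to alpha by continuity of H *)
Definition holonomy_map (alpha : R -> X) (tau U : set X) (h : X -> X) :=
  exists H : X * R -> X,
    [/\ {within (tau `&` U) `*` `[0, 1], continuous H},
        forall t, 0 <= t <= 1 -> H (alpha 0, t) = alpha t &
        forall y, (tau `&` U) y ->
          [/\ leafwise_path (fun t => H (y, t)), H (y, 0) = y,
              H (y, 1) = h y & tau (h y)]].

Definition without_holonomy :=
  forall (x : X) (alpha : R -> X) (tau U : set X) (h : X -> X),
    leafwise_path alpha -> alpha 0 = x -> alpha 1 = x ->
    small_transversal x tau -> nbhs x U ->
    holonomy_map alpha tau U h ->
    \forall y \near x, tau y -> h y = y.

End LeafTopology.

Section Integrability.
Context {R : realType} {d : nat} {M : manifold R d} {k q : nat}.
Variables (F : foliation R k q M) (E : M -> {vspace 'rV[R]_d}).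

(* plaques are C^1 immersed, with tangent spaces given by E *)
Definition tangent_foliation :=
  forall psi, fcharts F psi -> forall a b, ball 0 1 (a, b) ->
    let x := cinv psi (a, b) in
    let plaque := fun a' : 'rV[R]_k => chart x (cinv psi (a', b)) in
    [/\ C1_at a plaque,
        injective ('d plaque a) &
        range ('d plaque a) = [set` E x]].

Definition uniquely_integrates :=
  tangent_foliation /\
  forall (a b : R) (c : R -> M), tangent_curve E a b c ->
    forall t t', a < t < b -> a < t' < b -> leaf F (c t) (c t').

End Integrability.

Section UniversalCover.
Variable R : realType.
Context {Y X : topologicalType}.

Definition covering_map (p : Y -> X) :=
  [/\ continuous p, range p = setT &
      forall x, exists2 U, open_nbhs x U &
      exists sheets : set (set Y),
        [/\ \bigcup_(V in sheets) V = p @^-1` U,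
            trivIset sheets id &
            forall V, sheets V -> open V /\
              exists g : X -> Y, homeo_on V U p g]].

Definition simply_connected :=
  (exists _ : Y, True) /\
  (forall x y : Y, exists c : R -> Y,
    [/\ {within `[0, 1], continuous c}, c 0 = x & c 1 = y]) /\
  forall c : R -> Y, {within `[0, 1], continuous c} -> c 0 = c 1 ->
    exists H : R * R -> Y,
      [/\ {within `[0, 1] `*` `[0, 1], continuous H},
          forall t, 0 <= t <= 1 -> H (0, t) = c t /\ H (1, t) = c 0 &
          forall r, 0 <= r <= 1 -> H (r, 0) = c 0 /\ H (r, 1) = c 0].

Definition universal_cover (p : Y -> X) := covering_map p /\ simply_connected.

End UniversalCover.

Section GlobalProductStructure.
Context {R : realType} {d : nat} {M : manifold R d} {s c u : nat}.
Variables (Es Ec Eu : M -> {vspace 'rV[R]_d}).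
Variables (Ws : foliation R s (c + u) M) (Wc : foliation R c (s + u) M).
Variables (Wu : foliation R u (c + s) M).
Variables (Wcs : foliation R (c + s) u M) (Wcu : foliation R (c + u) s M).

Definition dynamically_coherent :=
  [/\ uniquely_integrates Wc Ec,
      uniquely_integrates Wcs (fun x => Ec x + Es x)%VS &
      uniquely_integrates Wcu (fun x => Ec x + Eu x)%VS].

Definition meet_once {Y : Type} (A B : set Y) := exists! z, (A `&` B) z.

Definition global_product_structure {Y : topologicalType} (p : Y -> M) :=
  dynamically_coherent /\
  forall x y : Y,
    [/\ meet_once (lifted_leaf Wu p x) (lifted_leaf Wcs p y),
        meet_once (lifted_leaf Ws p x) (lifted_leaf Wcu p y),
        lifted_leaf Wcs p y x ->
          meet_once (lifted_leaf Wc p x) (lifted_leaf Ws p y) &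
        lifted_leaf Wcu p y x ->
          meet_once (lifted_leaf Wc p x) (lifted_leaf Wu p y)].

End GlobalProductStructure.

(* Main.v *)
(* Let C, s, cs, ... denote the leaves on the universal cover Mt of the foliations
   Wc, Ws, Wcs, ... Global product structure provides, for y in s(x), a bijection
   C(x) -> C(y) sending z to the point of s(z) /\ C(y) = s(z) /\ cu(y), and similarly
   along unstable leaves; any two center leaves of Mt are related by two such maps.

   These maps are continuous because of a local product structure: for z close to w,
   the plaque of s through z meets the plaque of cu through w close to w.  Indeed the
   squared distance between these two plaques, in a chart, has a minimum which is
   interior (the leaves through w itself only meet at w), and, by transversality of
   Es and Ec + Eu, a critical point of the squared distance is a zero.

   To descend to M, let z, z' be two points of C(x) with the same projection, and lift
   the projection of a path of s(z) from z to w, starting at z', to a path from z' to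
   w'.  The set of times at which the two lifts lie in the same center leaf is open,
   since Wc has no holonomy, and closed, since the space of center leaves of Mt is
   Hausdorff (C is the intersection of cs and cu, and the leaf space of cs is
   parametrized by any leaf of u).  Hence w' is in C(w), so that w' is the image of z',
   and the images of z and z' have the same projection.

   Finally, a path of M contained in a leaf is continuous for the leaf topology, since
   a leaf meets a foliated chart in countably many plaques; this yields both the
   inclusions between leaves (C in cs, s in cs, ...) and the continuity, in the leaf
   topology, of the maps between center leaves of M. *)

Require Import Defs.
From HB Require Import structures.
From mathcomp Require Import all_boot all_order all_algebra.
From mathcomp Require Import all_classical all_reals all_analysis.
From mathcomp Require Import ring lra.
Import Order.TTheory GRing.Theory Num.Theory.
Import numFieldNormedType.Exports.
Local Open Scope classical_set_scope.
Local Open Scope ring_scope.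

Set Implicit Arguments.
Unset Strict Implicit.
Unset Printing Implicit Defensive.

(** * Paths *)

Section Paths.
Context {R : realType}.
Implicit Types (S T : topologicalType).

(** Retraction of the line onto the unit segment. Precomposing with it makes a path continuous
    within the segment continuous on all of [R], so that later arguments avoid subspace
    topologies. *)
Definition clamp (t : R) : R := Num.max 0 (Num.min t 1).

Lemma clamp_continuous : continuous clamp.
Proof.
move=> t; apply: (@continuous_max R R (fun=> 0) (fun t => Num.min t 1) t).
  exact: cst_continuous.
apply: (@continuous_min R R id (fun=> 1) t); first exact: cvg_id.
exact: cst_continuous.
Qed.

Lemma clamp_itv t : 0 <= clamp t <= 1.
Proof. by rewrite le_max lexx ge_max ler01 ge_min lexx orbT. Qed.

Lemma clampE t : 0 <= t <= 1 -> clamp t = t.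
Proof. by case/andP=> t0 t1; rewrite /clamp min_l// max_r. Qed.

Lemma clamp0 : clamp 0 = 0. Proof. by rewrite clampE ?lexx ?ler01. Qed.
Lemma clamp1 : clamp 1 = 1. Proof. by rewrite clampE ?lexx ?ler01. Qed.

Lemma clamp_path T (c : R -> T) :
  {within `[0, 1], continuous c} -> continuous (c \o clamp).
Proof.
move=> /subspace_continuousP cc t; have /= tI := clamp_itv t.
apply: (@cvg_comp _ _ _ clamp c _ (within `[0, 1] (nbhs (clamp t)))); last first.
  by apply: cc; rewrite /= in_itv.
move=> A /= wA; have := clamp_continuous wA.
rewrite !nbhs_simpl /=; apply: filterS => x; apply.
by rewrite /= in_itv /= clamp_itv.
Qed.

Lemma for_continuous_nbhs S T (f : S -> T) x (A : set T) :
  {for x, continuous f} -> nbhs (f x) A -> \forall y \near x, A (f y).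
Proof. by move=> cf /cf. Qed.

Lemma nbhs_sub T (x : T) (A B : set T) : nbhs x A -> A `<=` B -> nbhs x B.
Proof. by move=> nA AB; apply: filterS nA. Qed.

Lemma nbhs_for_continuous S T (f : S -> T) x :
  (forall A, nbhs (f x) A -> \forall y \near x, A (f y)) ->
  {for x, continuous f}.
Proof. by []. Qed.

Lemma for_continuous_pair S T (T' : topologicalType) (f : S -> T) (g : S -> T') x :
  {for x, continuous f} -> {for x, continuous g} ->
  {for x, continuous (fun s => (f s, g s))}.
Proof. by move=> cf cg; exact: (cvg_pair cf cg). Qed.

Lemma for_continuous_fst S T (x : S * T) : {for x, continuous fst}.
Proof. by case: x => x y; exact: cvg_fst. Qed.

Lemma for_continuous_snd S T (x : S * T) : {for x, continuous snd}.
Proof. by case: x => x y; exact: cvg_snd. Qed.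

Lemma for_continuousD S (V : normedModType R) (f g : S -> V) x :
  {for x, continuous f} -> {for x, continuous g} ->
  {for x, continuous (fun s => f s + g s)}.
Proof. by move=> cf cg; exact: (continuousD cf cg). Qed.

Lemma for_continuousB S (V : normedModType R) (f g : S -> V) x :
  {for x, continuous f} -> {for x, continuous g} ->
  {for x, continuous (fun s => f s - g s)}.
Proof. by move=> cf cg; exact: (continuousB cf cg). Qed.

Lemma for_continuousM S (f g : S -> R) x :
  {for x, continuous f} -> {for x, continuous g} ->
  {for x, continuous (fun s => f s * g s)}.
Proof. by move=> cf cg; exact: (continuousM cf cg). Qed.

Lemma for_continuous_comp S T (T' : topologicalType) (f : S -> T) (g : T -> T') x :
  {for x, continuous f} -> {for f x, continuous g} ->
  {for x, continuous (fun s => g (f s))}.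
Proof. by move=> cf cg; exact: (continuous_comp cf cg). Qed.

(** The test [b] may vary arbitrarily near [x]: both branches are close to the same value there. *)
Lemma continuous_if S T (f g : S -> T) (b : S -> bool) x :
  {for x, continuous f} -> {for x, continuous g} -> f x = g x ->
  {for x, continuous (fun s => if b s then f s else g s)}.
Proof.
move=> cf cg e; apply: nbhs_for_continuous => A.
have -> : (if b x then f x else g x) = f x by case: ifP.
move=> nA; have nA' : nbhs (g x) A by rewrite -e.
apply: filterS2 (for_continuous_nbhs cf nA) (for_continuous_nbhs cg nA').
by move=> s fs gs; case: (b s).
Qed.

Lemma continuous_eq_near S T (f g : S -> T) x :
  (\forall s \near x, f s = g s) ->
  {for x, continuous f} -> {for x, continuous g}.
Proof.
move=> e cf; apply: nbhs_for_continuous => A; rewrite -(nbhs_singleton e).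
by move=> /(for_continuous_nbhs cf); apply: filterS2 e => s ->.
Qed.

(** The parameter space [S] lets one construction join families of paths and, with a dummy
    parameter, single paths. *)
Definition concat {S T : Type} (H1 H2 : S * R -> T) (s : S * R) : T :=
  if s.2 <= 2^-1 then H1 (s.1, 2 * s.2) else H2 (s.1, 2 * s.2 - 1).

Lemma concat_continuous S T (H1 H2 : S * R -> T) x t :
  (forall t, {for (x, t), continuous H1}) ->
  (forall t, {for (x, t), continuous H2}) ->
  H1 (x, 1) = H2 (x, 0) ->
  {for (x, t), continuous (concat H1 H2)}.
Proof.
move=> c1 c2 e.
have d a : {for (x, t), continuous (fun s : S * R => (s.1, 2 * s.2 + a))}.
  apply: for_continuous_pair; first exact: for_continuous_fst.
  apply: for_continuousD.
    by apply: for_continuousM; [exact: cst_continuous|exact: for_continuous_snd].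
  exact: cst_continuous.
have d1 : {for (x, t), continuous (fun s : S * R => H1 (s.1, 2 * s.2))}.
  apply: (@continuous_comp _ _ _ (fun s : S * R => (s.1, 2 * s.2)) H1).
    suff -> : (fun s : S * R => (s.1, 2 * s.2)) = fun s => (s.1, 2 * s.2 + 0).
      exact: d.
    by apply: funext => s; rewrite addr0.
  exact: c1.
have d2 : {for (x, t), continuous (fun s : S * R => H2 (s.1, 2 * s.2 - 1))}.
  apply: (@continuous_comp _ _ _ (fun s : S * R => (s.1, 2 * s.2 - 1)) H2).
    exact: d.
  exact: c2.
have [tl|tg|te] := ltgtP t 2^-1.
- apply: continuous_eq_near d1.
  apply: nbhs_sub (for_continuous_nbhs (for_continuous_snd (x:=(x, t))) (lt_nbhsl tl)) _.
  by move=> s /= sl; rewrite /concat (ltW sl).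
- apply: continuous_eq_near d2.
  apply: nbhs_sub (for_continuous_nbhs (for_continuous_snd (x:=(x, t))) (lt_nbhsr tg)) _.
  by move=> s /= sl; rewrite /concat leNgt sl.
- apply: (continuous_if d1 d2); rewrite /= te divff ?subrr ?e//.
Qed.

(** The set of times satisfying [P] is open and closed in the connected line. This is the form in
    which every continuation along a path is carried out. *)
Lemma locally_constant (P : R -> Prop) :
  (forall t, \forall t' \near t, P t' <-> P t) -> forall a b, P a -> P b.
Proof.
move=> lc a b Pa; have /connected_intervalP c : is_interval [set: R] by [].
suff : [set t | P t] = setT by move=> e; have : [set: R] b by []; rewrite -e.
apply: c; first by exists a.
- exists [set t | P t]; rewrite ?setTI// openE => t Pt.
  by apply: filterS (lc t) => t' e; apply/e.
- exists [set t | P t]; rewrite ?setTI// => t /(_ _ (lc t)) [t' [Pt' e]].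
  exact/e.
Qed.

Lemma locally_constant_segment (P : R -> Prop) :
  (forall t : R, 0 <= t <= 1 -> \forall t' \near t, 0 <= t' <= 1 -> (P t' <-> P t)) ->
  P 0 -> P 1.
Proof.
move=> lc; rewrite -{1}clamp0 -{1}clamp1.
apply: (@locally_constant (P \o clamp)) => t.
have := clamp_continuous (lc _ (clamp_itv t)).
by rewrite nbhs_simpl/=; apply: filterS => t' /= /(_ (clamp_itv t')).
Qed.

Lemma concat_path_continuous T (c c' : R -> T) :
  continuous c -> continuous c' -> c 1 = c' 0 ->
  continuous (fun t => concat (fun s => c s.2) (fun s => c' s.2) (0 : R, t)).
Proof.
move=> cc cc' e t; apply: (@for_continuous_comp _ _ _ (fun t => (0 : R, t)) (concat _ _)).
  by apply: for_continuous_pair; [exact: cst_continuous|exact: cvg_id].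
by apply: concat_continuous => // u; apply: for_continuous_comp;
  [exact: for_continuous_snd|exact: cc|exact: for_continuous_snd|exact: cc'].
Qed.

Lemma concat0 S T (H1 H2 : S * R -> T) x : concat H1 H2 (x, 0) = H1 (x, 0).
Proof. by rewrite /concat /= mulr0 invr_ge0 ler0n. Qed.

Lemma concat1 S T (H1 H2 : S * R -> T) x : concat H1 H2 (x, 1) = H2 (x, 1).
Proof.
rewrite /concat /= lt_geF ?invf_lt1 ?ltr1n// mulr1.
by rewrite (_ : 2 - 1 = 1)//; lra.
Qed.

Lemma concat_ind S T (H1 H2 : S * R -> T) (P : T -> Prop) x t :
  (forall t, P (H1 (x, t))) -> (forall t, P (H2 (x, t))) ->
  P (concat H1 H2 (x, t)).
Proof. by rewrite /concat; case: ifP. Qed.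

(** Common form of [leaf] and [lifted_leaf], with paths defined on the whole line, so that the laws
    of an equivalence relation are proved once for both. *)
Definition joined T (A : set T) (x y : T) := exists c : R -> T,
  [/\ continuous c, forall t, A (c t), c 0 = x & c 1 = y].

Lemma joined_refl T (A : set T) x : A x -> joined A x x.
Proof. by exists (fun=> x); split=> //; exact: cst_continuous. Qed.

Lemma joined_sym T (A : set T) x y : joined A x y -> joined A y x.
Proof.
case=> c [cc cA c0 c1]; exists (fun t => c (1 - t)); split=> [t|t||] //.
- have cB : {for t, continuous (fun t : R => 1 - t)}.
    by apply: for_continuousB; [exact: cst_continuous|exact: cvg_id].
  exact: (for_continuous_comp cB (cc _)).
- by rewrite subr0.
- by rewrite subrr.
Qed.

Lemma joined_trans T (A : set T) x y z :
  joined A x y -> joined A y z -> joined A x z.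
Proof.
case=> c [cc cA c0 c1] [c' [cc' cA' c'0 c'1]].
exists (fun t => concat (fun s => c s.2) (fun s => c' s.2) (0 : R, t)); split.
- by apply: concat_path_continuous; rewrite // c1.
- by move=> t; apply: concat_ind.
- by rewrite concat0.
- by rewrite concat1.
Qed.

End Paths.
Arguments joined R {T} A x y.

(** * Leaf topology *)

Section LeafTopologyTheory.
Context {R : realType} {k q : nat} {X : topologicalType}.
Variable F : foliation R k q X.
Implicit Types (psi : pchart X ('rV[R]_k * 'rV[R]_q)%type) (x y z : X).

Lemma leaf_nbhs_plaque x (A : set (leaf_space F)) psi :
  nbhs (x : leaf_space F) A -> fcharts F psi -> cdom psi x ->
  \forall y \near x, (psi y).2 = (psi x).2 -> A y.
Proof.
rewrite nbhsE => -[B [oB Bx] BA] Fpsi psix.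
by apply: filterS (oB x Bx psi Fpsi psix) => y yB e; apply/BA/yB.
Qed.

(** [leaf_open] tests all foliated charts; here a single chart suffices. The part of the plaque of
    [x] inside an open set is leaf open, because near each of its points the plaques of any other
    chart coincide with those of [psi]. *)
Lemma plaque_leaf_nbhs x (A : set (leaf_space F)) psi :
  fcharts F psi -> cdom psi x ->
  (\forall y \near x, (psi y).2 = (psi x).2 -> A y) ->
  nbhs (x : leaf_space F) A.
Proof.
move=> Fpsi psix; rewrite /prop_near1 (@nbhsE X x) => -[V [oV Vx] VA].
have oB : @leaf_open R k q X F [set y | [/\ V y, cdom psi y & (psi y).2 = (psi x).2]].
  move=> y [Vy psiy e] psi' Fpsi' psi'y.
  have [U Uy UP] := fcharts_compat Fpsi Fpsi' psiy psi'y.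
  have Uyy := nbhs_singleton Uy.
  have nV : nbhs y V by apply: open_nbhs_nbhs.
  have nD : nbhs y (cdom psi).
    by apply: open_nbhs_nbhs; split=> //; exact: cdom_open.
  apply: filterS3 nV nD Uy => z Vz Dz Uz e'; split=> //; rewrite -e.
  exact: (UP z y Uz Uyy).2 e'.
rewrite (@nbhsE (leaf_space F) x).
exists [set y | [/\ V y, cdom psi y & (psi y).2 = (psi x).2]].
  by split; [exact: oB|].
by move=> y [Vy _]; apply: VA.
Qed.

Lemma leaf_continuous_continuous (T : topologicalType) (f : T -> X) t :
  {for t, continuous (f : T -> leaf_space F)} -> {for t, continuous f}.
Proof.
move=> cf; apply: nbhs_for_continuous => A nA; apply: (for_continuous_nbhs cf).
have [psi Fpsi psix] := fcharts_cover F (f t).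
by apply: (plaque_leaf_nbhs Fpsi psix); apply: filterS nA.
Qed.

Lemma leaf_continuousP (T : topologicalType) (f : T -> X) t psi :
  fcharts F psi -> cdom psi (f t) ->
  {for t, continuous (f : T -> leaf_space F)} <->
  {for t, continuous f} /\ \forall s \near t, (psi (f s)).2 = (psi (f t)).2.
Proof.
move=> Fpsi psit; split=> [cf|[cf e]].
  split; first exact: leaf_continuous_continuous.
  pose A : set (leaf_space F) := [set y | (psi y).2 = (psi (f t)).2].
  apply: (for_continuous_nbhs cf (A := A)).
  by apply: (plaque_leaf_nbhs Fpsi psit); exact: nearW.
apply: nbhs_for_continuous => A /leaf_nbhs_plaque /(_ Fpsi psit).
by move=> /(for_continuous_nbhs cf); apply: filterS2 e => s e; apply.
Qed.

Lemma leafP x y : leaf F x y <-> joined R (@setT (leaf_space F)) x y.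
Proof.
split=> -[c [cc]]; last first.
  by exists c; split=> //; apply: continuous_subspaceT.
by move=> c0 c1; exists (c \o clamp); split=> //;
  [exact: clamp_path|rewrite /= clamp0|rewrite /= clamp1].
Qed.

Lemma leaf_refl x : leaf F x x.
Proof. exact/leafP/joined_refl. Qed.

Lemma leaf_sym x y : leaf F x y -> leaf F y x.
Proof. by move=> /leafP xy; apply/leafP/joined_sym. Qed.

Lemma leaf_trans x y z : leaf F x y -> leaf F y z -> leaf F x z.
Proof. by move=> /leafP xy /leafP yz; apply/leafP/(joined_trans xy yz). Qed.

End LeafTopologyTheory.

(** * Countability of the plaques of a leaf, and paths contained in a leaf *)

Section PathsInLeaves.
Context {R : realType}.

(** A nondegenerate interval has positive Lebesgue measure, whereas countable sets are null. *)
Lemma countable_connected (A : set R) x y :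
  countable A -> connected A -> A x -> A y -> x = y.
Proof.
move=> cA /connected_intervalP iA.
wlog xy : x y / x <= y => [W|] Ax Ay.
  by have [|/ltW] := leP x y => ?; [apply: W|symmetry; apply: W].
have /countable_lebesgue_measure0 : countable `[x, y].
  apply: sub_countable cA; apply: subset_card_le => z /=.
  by rewrite in_itv /=; exact: iA.
rewrite lebesgue_measure_itv /= lte_fin.
case: ltP => [lt [] /eqP|yx _]; last by apply/eqP; rewrite eq_le xy.
by rewrite -/(y - x) subr_eq0 => /eqP.
Qed.

Lemma countable_image_constant (f : R -> R) (J : set R) s t :
  is_interval J -> {in J, continuous f} -> countable (f @` J) ->
  J s -> J t -> f s = f t.
Proof.
move=> iJ cf cfJ Js Jt; apply: (countable_connected cfJ); try exact: imageP.
apply: connected_continuous_connected; first exact/connected_intervalP.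
exact: continuous_in_subspaceT.
Qed.

Lemma rat_row_dense k (a : 'rV[R]_k) (A : set 'rV[R]_k) : nbhs a A ->
  exists r : 'rV[rat]_k, A (map_mx ratr r).
Proof.
move=> /nbhs_ballP[e /= e0 eA].
have h j : exists r : rat, `|a ord0 j - ratr r| < e.
  have /rat_in_itvoo[r] : a ord0 j < a ord0 j + e by rewrite ltrDl.
  rewrite in_itv /= => /andP[r1 r2]; exists r.
  by rewrite distrC ger0_norm ?subr_ge0 ?ltW// ltrBlDl.
exists (\row_j sval (cid (h j))); apply: eA; split=> // i j.
by rewrite (ord1 i) !mxE; case: cid.
Qed.

Section Charts.
Context {X V : topologicalType}.
Variable psi : pchart X V.

Lemma cdom_nbhs x : cdom psi x -> nbhs x (cdom psi).
Proof. by move=> xD; apply: open_nbhs_nbhs; split=> //; exact: cdom_open. Qed.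

Lemma cimg_nbhs v : cimg psi v -> nbhs v (cimg psi).
Proof. by move=> vD; apply: open_nbhs_nbhs; split=> //; exact: cimg_open. Qed.

Lemma cmap_continuous x : cdom psi x -> {for x, continuous psi}.
Proof.
move=> xD; have [cc _ _ _ _] := chart_homeo psi; move: cc.
by rewrite continuous_open_subspace ?inE; [apply; rewrite inE|exact: cdom_open].
Qed.

Lemma cinv_continuous v : cimg psi v -> {for v, continuous (cinv psi)}.
Proof.
move=> vD; have [_ cc _ _ _] := chart_homeo psi; move: cc.
by rewrite continuous_open_subspace ?inE; [apply; rewrite inE|exact: cimg_open].
Qed.

Lemma cmapK x : cdom psi x -> cinv psi (psi x) = x.
Proof. by have [_ _ _ _ [h _]] := chart_homeo psi; exact: h. Qed.

Lemma cinvK v : cimg psi v -> psi (cinv psi v) = v.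
Proof. by have [_ _ _ _ [_ h]] := chart_homeo psi; exact: h. Qed.

Lemma cmap_img x : cdom psi x -> cimg psi (psi x).
Proof. by have [_ _ h _ _] := chart_homeo psi => xD; apply: h; exists x. Qed.

Lemma cinv_dom v : cimg psi v -> cdom psi (cinv psi v).
Proof. by have [_ _ _ h _] := chart_homeo psi => vD; apply: h; exists v. Qed.

End Charts.

Context {k q : nat} {X : topologicalType}.
Variable F : foliation R k q X.

Lemma leaf_continuous_plaque (T : topologicalType) (f : T -> X) t :
  {for t, continuous (f : T -> leaf_space F)} ->
  exists2 psi, fcharts F psi & cdom psi (f t) /\
    \forall s \near t, cdom psi (f s) /\ (psi (f s)).2 = (psi (f t)).2.
Proof.
move=> cf; have [psi Fpsi psit] := fcharts_cover F (f t); exists psi => //.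
have [cf' e] := (leaf_continuousP Fpsi psit).1 cf; split=> //.
by apply: filterI e; apply: (for_continuous_nbhs cf'); exact: cdom_nbhs.
Qed.

Hypothesis X2 : @second_countable X.

Lemma countable_atlas (x0 : X) :
  exists psi : nat -> pchart X ('rV[R]_k * 'rV[R]_q)%type,
  (forall n, fcharts F (psi n)) /\ forall x, exists n, cdom (psi n) x.
Proof.
have [B /countable_injP[f finj] [_ Bb]] := X2.
have [psi0 Fpsi0 _] := fcharts_cover F x0.
(* The chart of index [n] contains the basic open set of code [n] whenever some foliated chart does;
   otherwise it is the default [psi0]. *)
have h n : exists psi, fcharts F psi /\
    forall V psi', B V -> f V = n -> fcharts F psi' -> V `<=` cdom psi' ->
      V `<=` cdom psi.
  have [[V [BV fV [psi Fpsi Vpsi]]]|N] := pselect (exists V, [/\ B V, f V = n &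
    exists2 psi, fcharts F psi & V `<=` cdom psi]).
    exists psi; split=> // V' psi' BV' fV' _ _.
    by rewrite (_ : V' = V)//; apply: finj; rewrite ?inE// fV.
  exists psi0; split=> // V psi BV fV Fpsi Vpsi; exfalso; apply: N.
  by exists V; split=> //; exists psi.
exists (fun n => sval (cid (h n))); split=> [n|x]; first by case: cid => ? [].
have [psi Fpsi psix] := fcharts_cover F x.
have [V [BV Vx] Vpsi] := Bb x _ (cdom_nbhs psix).
exists (f V); case: cid => psi' [_ /(_ V psi BV)] /=; apply=> //.
Qed.

(* The points visited by finite chains of plaques of a countable atlas, each plaque
   being entered at a point with rational coordinates, are dense in the leaf. *)
Lemma leaf_separable (x0 : X) : exists2 D : set X, countable D &
  forall y (A : set (leaf_space F)), leaf F x0 y -> nbhs (y : leaf_space F) A ->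
    exists2 d, D d & A d.
Proof.
have [psi [Fpsi psiC]] := countable_atlas x0.
(* Applied outside the domain of a chart, [act] gives arbitrary points; they only enlarge the
   countable set [D]. *)
pose act (l : nat * 'rV[rat]_k) x :=
  cinv (psi l.1) (map_mx ratr l.2, (psi l.1 x).2).
pose D := range (foldr act x0).
exists D; first by apply: (sub_countable (card_image_le _ _)).
pose Cl (y : X) := forall A : set (leaf_space F), nbhs (y : leaf_space F) A ->
  exists2 d, D d & A d.
(* Adherence to [D] spreads from one point of a plaque to the whole plaque; continuation along a
   leafwise path from [x0] then reaches every point of the leaf. *)
suff ClP n y z : cdom (psi n) y -> cdom (psi n) z ->
    (psi n y).2 = (psi n z).2 -> Cl y -> Cl z.
  move=> y A [c [cc c0 c1]]; suff : Cl y by apply.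
  rewrite -c1 -clamp1; have := clamp_path cc; set e := c \o clamp => ce.
  change (Cl (e 1)); apply: (@locally_constant _ (Cl \o e) _ 0) => [t|]; last first.
    rewrite /e /= clamp0 c0 => B nB; exists x0; first by exists [::].
    exact: nbhs_singleton nB.
  have [n nt] := psiC (e t).
  have [ce' et] := (leaf_continuousP (Fpsi n) nt).1 (ce t).
  have := for_continuous_nbhs ce' (cdom_nbhs nt).
  by apply: filterS2 et => s es ns; split; apply: (ClP n).
move=> ny nz yz Cly A nA.
have [d Dd [nd dy]] : exists2 d, D d & cdom (psi n) d /\ (psi n d).2 = (psi n y).2.
  apply: Cly; apply: (plaque_leaf_nbhs (Fpsi n) ny).
  by apply: filterS (cdom_nbhs ny).
have := leaf_nbhs_plaque nA (Fpsi n) nz.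
have imz := cmap_img nz; have cz : {for ((psi n z).1, (psi n z).2),
    continuous (cinv (psi n))} by rewrite -surjective_pairing; exact: cinv_continuous.
have cz' : {for (psi n z).1, continuous (fun a => cinv (psi n) (a, (psi n z).2))}.
  apply: (for_continuous_comp _ cz).
  by apply: for_continuous_pair; [exact: cvg_id|exact: cst_continuous].
rewrite -{1}(cmapK nz) (surjective_pairing (psi n z)).
move=> /(for_continuous_nbhs cz') near_A.
have near_im : \forall a \near (psi n z).1, cimg (psi n) (a, (psi n z).2).
  apply: (@for_continuous_nbhs _ _ (fun a => (a, (psi n z).2)) _ (cimg (psi n))).
    by apply: for_continuous_pair; [exact: cvg_id|exact: cst_continuous].
  by rewrite -surjective_pairing; exact: cimg_nbhs.
have [r [rA rim]] := rat_row_dense (filterI near_A near_im).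
exists (act (n, r) d); first by case: Dd => l _ <-; exists ((n, r) :: l).
by rewrite /act /= dy yz; apply: rA; rewrite cinvK.
Qed.

(** Each plaque is a leaf neighbourhood of its points, so every plaque met by the leaf contains a
    point of the countable dense set. *)
Lemma leaf_transversal_countable (x0 : X) psi : fcharts F psi ->
  countable [set b | exists y, [/\ leaf F x0 y, cdom psi y & (psi y).2 = b]].
Proof.
move=> Fpsi; have [D Dc Dd] := leaf_separable x0.
apply: (@sub_countable _ _ _ ((fun y => (psi y).2) @` D)); last first.
  exact: (sub_countable (card_image_le _ _)).
apply: subset_card_le => _ [y [x0y yD <-]].
have [|d Dd' e] := Dd y [set d | (psi d).2 = (psi y).2] x0y.
  by apply: (plaque_leaf_nbhs Fpsi yD); exact: nearW.
by exists d.
Qed.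

(** On a small ball of times each transverse coordinate of the path is continuous with countably
    many values, hence constant: the path stays in one plaque. *)
Lemma path_in_leaf_leafwise (x0 : X) (c : R -> X) :
  continuous c -> (forall t, leaf F x0 (c t)) ->
  continuous (c : R -> leaf_space F).
Proof.
move=> cc cl t; have [psi Fpsi psit] := fcharts_cover F (c t).
apply/(leaf_continuousP Fpsi psit); split; first exact: cc.
have /nbhs_ballP[e /= e0 eD] := for_continuous_nbhs (cc t) (cdom_nbhs psit).
near=> s; have ts : ball t e s by near: s; exact: nbhsx_ballx.
apply/rowP => j.
apply: (@countable_image_constant (fun s => (psi (c s)).2 ord0 j) (ball t e)) => //.
- move=> a b; rewrite ball_itv /= !in_itv /= => /andP[a1 a2] /andP[b1 b2] u.
  by move=> /andP[u1 u2]; apply/andP; split; [exact: lt_le_trans u1|exact: le_lt_trans b2].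
- move=> u; rewrite inE => tu.
  apply: (@for_continuous_comp R _ _ (fun s => (psi (c s)).2)
    (fun b : 'rV[R]_q => b ord0 j)); last first.
    exact: coord_continuous.
  apply: (@for_continuous_comp R _ _ (fun s => psi (c s)) snd); last first.
    exact: for_continuous_snd.
  by apply: for_continuous_comp; [exact: cc|exact/cmap_continuous/eD].
- have := leaf_transversal_countable x0 Fpsi; set B := (B in countable B) => cB.
  apply: (@sub_countable _ _ _ ((fun b : 'rV[R]_q => b ord0 j) @` B)); last first.
    exact: (sub_countable (card_image_le _ _)).
  apply: subset_card_le => _ [u tu <-]; exists ((psi (c u)).2) => //.
  by exists (c u); split=> //; exact: eD.
- exact: ballxx.
Unshelve. all: by end_near. Qed.

End PathsInLeaves.

(** * Coverings *)

Lemma hausdorff_near (T : topologicalType) (x y : T) : hausdorff_space T ->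
  x <> y -> exists A B : set T, [/\ nbhs x A, nbhs y B & A `&` B = set0].
Proof.
move=> hT xy; apply: contrapT => N; apply: xy; apply: hT => A B nA nB.
by apply/set0P/eqP => AB; apply: N; exists A, B.
Qed.

Section Covering.
Context {R : realType} {Y X : topologicalType}.
Variable p : Y -> X.
Hypothesis pcov : covering_map p.

Lemma covering_continuous : continuous p. Proof. by case: pcov. Qed.

Lemma covering_surj x : exists y, p y = x.
Proof.
by case: pcov => _ e _; have : [set: X] x by []; rewrite -e => -[y _ <-]; exists y.
Qed.

(** The family of sheets is replaced by one sheet [V] around [y] with its section [g]. The last
    clause separates [y] from the rest of its fibre, as needed for the Hausdorff property. *)
Lemma evenly_covered x : exists2 U, open_nbhs x U &
  forall y, U (p y) -> exists V, exists g : X -> Y,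
    [/\ open V, V y, forall z, V z -> U (p z) /\ g (p z) = z,
      forall z, U z -> [/\ V (g z), p (g z) = z & {for z, continuous g}] &
      forall y', p y' = p y -> y' <> y ->
        exists2 V', open V' & V' y' /\ V `&` V' = set0].
Proof.
have [_ _ /(_ x)[U [oU Ux] [sheets [sU tsh hsh]]]] := pcov; exists U => //.
have sh y : U (p y) -> exists2 V, sheets V & V y.
  by move=> Uy; have : (p @^-1` U) y by []; rewrite -sU => -[V sV Vy]; exists V.
move=> y Uy; have [V sV Vy] := sh y Uy.
have [oV [g [_ cg pV gU [gK pK]]]] := hsh V sV.
have VU z : V z -> U (p z) by move=> Vz; apply: pV; exists z.
exists V, g; split=> // [z Vz|z Uz|y' yy' ny].
- by rewrite gK//; split=> //; exact: VU.
- split; [by apply: gU; exists z|exact: pK|].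
  by move: cg; rewrite continuous_open_subspace// => /(_ z); apply; rewrite inE.
- have [|V' sV' V'y] := sh y'; first by rewrite yy'.
  have [oV' _] := hsh V' sV'; exists V' => //; split=> //.
  rewrite -subset0 => z [Vz V'z].
  have VV' : V = V' by apply: tsh => //; exists z.
  by apply: ny; have := gK _ Vy; rewrite -yy' gK// VV'.
Qed.

(** Two points of one fibre are separated by disjoint sheets, points of different fibres by
    preimages of open sets of [X]. *)
Lemma covering_hausdorff : hausdorff_space X -> hausdorff_space Y.
Proof.
move=> hX y y' clyy'; apply: contrapT => nyy'.
have [yy'|ny] := pselect (p y' = p y).
  have [U [_ Uy] /(_ y)/(_ Uy)[V [g [oV Vy _ _ h]]]] := evenly_covered (p y).
  have [|V' oV' [Vy' VV']] := h y' yy'; first by move=> e; apply: nyy'.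
  have [z] := clyy' V V' (open_nbhs_nbhs (conj oV Vy)) (open_nbhs_nbhs (conj oV' Vy')).
  by rewrite VV'.
have [|A [B [nA nB AB]]] := hausdorff_near (x := p y) (y := p y') hX.
  by move=> e; apply: ny.
have [z [Az Bz]] := clyy' _ _ (covering_continuous nA) (covering_continuous nB).
by have : (A `&` B) (p z) by []; rewrite AB.
Qed.

Lemma paste_continuous (T : topologicalType) (f g : R -> T) t :
  continuous f -> continuous g -> f t = g t ->
  continuous (fun s => if s <= t then f s else g s).
Proof.
move=> cf cg e s; have [st|ts|->] := ltgtP s t.
- apply: (continuous_eq_near _ (cf s)); apply: filterS (lt_nbhsl st) => u ut.
  by rewrite ltW.
- apply: (continuous_eq_near _ (cg s)); apply: filterS (lt_nbhsr ts) => u ut.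
  by rewrite leNgt ut.
- exact: (@continuous_if _ _ f g (fun s => s <= t) t (cf t) (cg t) e).
Qed.

(** The property that a lift exists up to time [t] is locally constant: inside an evenly covered
    set, a lift is prolonged by the section of its sheet. *)
Lemma path_lifting (c : R -> X) y : continuous c -> p y = c 0 ->
  exists c' : R -> Y, [/\ continuous c', c' 0 = y &
    forall t, 0 <= t <= 1 -> p (c' t) = c t].
Proof.
move=> cc yc.
pose P t := exists c' : R -> Y, [/\ continuous c', c' 0 = y &
  forall s, 0 <= s <= t -> p (c' s) = c s].
apply: (locally_constant_segment (P := P)) => [t /andP[t_ge0 _]|]; last first.
  exists (fun=> y); split=> // [|s]; first exact: cst_continuous.
  by rewrite -eq_le => /eqP <-.
have [U [oU Ut] Uy] := evenly_covered (c t).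
have nU : nbhs (c t) U by apply: open_nbhs_nbhs.
have /nbhs_ballP[e /= e0 eU] := for_continuous_nbhs (cc t) nU.
suff lift t1 t2 : ball t e t1 -> ball t e t2 -> 0 <= t1 -> t1 <= t2 -> P t1 -> P t2.
  exists e => //= t' tt' /andP[t'0 t'1]; have tt := ballxx t e0.
  have PS a b : a <= b -> P b -> P a.
    move=> ab [c' [cc' c'0 c'p]]; exists c'; split=> // s /andP[s0 sa].
    by rewrite c'p ?s0 ?(le_trans sa).
  have [tt'l|/ltW t't] := leP t t'; split.
  - exact: PS.
  - exact: lift.
  - exact: lift.
  - exact: PS.
move=> b1 b2 t10 t12 [c' [cc' c'0 c'p]].
have pt1 : p (c' t1) = c t1 by rewrite c'p ?t10/=.
have [|V [g [oV Vt Vg Ug _]]] := Uy (c' t1); first by rewrite pt1; exact: eU.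
(* Clamping time to the segment from [t1] to [t2] keeps the argument of [g] inside [U], so the
   prolonged lift is continuous on the whole line. *)
pose cl s := Num.max t1 (Num.min s t2).
have cl_c : continuous cl.
  move=> s; apply: (@continuous_max R R (fun=> t1) (fun s => Num.min s t2) s).
    exact: cst_continuous.
  apply: (@continuous_min R R id (fun=> t2) s); first exact: cvg_id.
  exact: cst_continuous.
have clU s : U (c (cl s)).
  apply: eU; move: b1 b2; rewrite ball_itv /= !in_itv /= => /andP[b1 _] /andP[_ b2].
  rewrite /cl lt_max gt_max b1/= (le_lt_trans t12 b2)/=.
  by rewrite gt_min b2 orbT.
exists (fun s => if s <= t1 then c' s else g (c (cl s))); split.
- apply: paste_continuous => //; last first.
    by rewrite /cl min_l// maxxx -pt1; case: (Vg _ Vt).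
  move=> s; have [_ _ cg] := Ug _ (clU s).
  exact: (for_continuous_comp (for_continuous_comp (cl_c s) (cc _)) cg).
- by rewrite t10.
- move=> s /andP[s0 st2]; case: leP => st1; first by rewrite c'p ?s0.
  by have [_ -> _] := Ug _ (clU s); rewrite /cl min_l// max_r// ltW.
Qed.

End Covering.

(** * Lifted leaves *)

Lemma for_continuous_pairl (S T : topologicalType) (x : S) (y : T) :
  {for x, continuous (fun x => (x, y))}.
Proof. by apply: for_continuous_pair; [exact: cvg_id|exact: cst_continuous]. Qed.

Lemma for_continuous_pairr (S T : topologicalType) (x : S) (y : T) :
  {for y, continuous (fun y => (x, y))}.
Proof. by apply: for_continuous_pair; [exact: cst_continuous|exact: cvg_id]. Qed.

Lemma ball_segment (R : realType) (V : normedModType R) (a u v : V) (e t : R) :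
  ball a e u -> ball a e v -> 0 <= t <= 1 -> ball a e ((1 - t) *: u + t *: v).
Proof.
rewrite -!ball_normE /= => au av /andP[t0 t1].
rewrite (_ : a - _ = (1 - t) *: (a - u) + t *: (a - v)); last first.
  by rewrite !scalerBr addrACA -scalerDl subrK scale1r opprD.
apply: le_lt_trans (ler_normD _ _) _.
rewrite !normrZ !ger0_norm ?subr_ge0//.
have [->|t_neq0] := eqVneq t 0; first by rewrite subr0 mul1r mul0r addr0.
rewrite [ltRHS](_ : e = (1 - t) * e + t * e); last by rewrite -mulrDl subrK mul1r.
apply: ler_ltD; first by rewrite ler_wpM2l ?subr_ge0// ltW.
by rewrite ltr_pM2l// lt_neqAle eq_sym t_neq0.
Qed.

Section Lifts.
Context {R : realType} {k q : nat} {Y X : topologicalType}.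
Variables (F : foliation R k q X) (p : Y -> X).
Hypothesis pcov : covering_map p.

(* A foliated chart lifted to Y, and restricted to a ball. *)
Record flowbox (psi : pchart X ('rV[R]_k * 'rV[R]_q)%type) (y0 : Y) (e : R)
    (N : set Y) (th : 'rV[R]_k * 'rV[R]_q -> Y) : Prop := Flowbox {
  box_gt0 : 0 < e ;
  box_open : open N ;
  box_center : N y0 ;
  box_dom : forall y, N y -> cdom psi (p y) ;
  box_ball : forall y, N y -> ball (psi (p y0)) e (psi (p y)) ;
  boxK : forall y, N y -> th (psi (p y)) = y ;
  box_img : forall v, ball (psi (p y0)) e v -> N (th v) ;
  box_invK : forall v, ball (psi (p y0)) e v -> psi (p (th v)) = v ;
  box_continuous : forall v, ball (psi (p y0)) e v -> {for v, continuous th} }.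

Lemma flowbox_exists psi y0 (W : set Y) : cdom psi (p y0) -> nbhs y0 W ->
  exists e, exists N, exists2 th, flowbox psi y0 e N th & N `<=` W.
Proof.
move=> psiy0 nW; pose v0 := psi (p y0).
have [U [oU Uy0] /(_ y0 Uy0)[V [g [oV Vy0 Vg Ug _]]]] := evenly_covered pcov (p y0).
have imv0 : cimg psi v0 by exact: cmap_img.
have cv0 : {for v0, continuous (cinv psi)} by exact: cinv_continuous.
have ev0 : cinv psi v0 = p y0 by rewrite cmapK.
have [_ gpy0] := Vg _ Vy0; have [_ _ cg] := Ug _ Uy0.
have near1 : \forall v \near v0, U (cinv psi v).
  by apply: (for_continuous_nbhs cv0); apply: open_nbhs_nbhs; rewrite ev0.
have near2 : \forall v \near v0, W (g (cinv psi v)).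
  have cgv : {for v0, continuous (fun v => g (cinv psi v))}.
    by apply: for_continuous_comp => //; rewrite ev0.
  by apply: (for_continuous_nbhs cgv); rewrite ev0 gpy0.
have : nbhs v0 [set v | [/\ cimg psi v, U (cinv psi v) & W (g (cinv psi v))]].
  by apply: filterS3 (cimg_nbhs imv0) near1 near2 => v.
move=> /nbhs_ballP[e /= e0 eB].
pose N := [set y | [/\ V y, cdom psi (p y) & ball v0 e (psi (p y))]].
exists e, N, (g \o cinv psi).
  split=> //.
  - rewrite openE => y [Vy Dy By].
    have nV : nbhs y V by apply: open_nbhs_nbhs.
    have cp := covering_continuous pcov (x:=y).
    have nD := for_continuous_nbhs cp (cdom_nbhs Dy).
    have cpsi : {for y, continuous (fun y => psi (p y))}.
      exact: (for_continuous_comp cp (cmap_continuous Dy)).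
    have nB : nbhs (psi (p y)) (ball v0 e).
      by apply: open_nbhs_nbhs; split=> //; exact: ball_open.
    by apply: filterS3 nV nD (for_continuous_nbhs cpsi nB) => z Vz Dz Bz; split.
  - by split=> //; exact: ballxx.
  - by move=> y [].
  - by move=> y [].
  - by move=> y [Vy Dy _] /=; rewrite cmapK//; case: (Vg _ Vy).
  - move=> v vB; have [vi Uv _] := eB _ vB.
    have [Vv pv _] := Ug _ Uv; split=> //=; rewrite pv ?cinvK//.
    exact: cinv_dom.
  - move=> v vB; have [vi Uv _] := eB _ vB.
    by have [_ pv _] := Ug _ Uv; rewrite /= pv cinvK.
  - move=> v vB; have [vi Uv _] := eB _ vB.
    have [_ _ cgv] := Ug _ Uv.
    exact: (for_continuous_comp (cinv_continuous vi) cgv).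
move=> y [Vy Dy By]; have [_ _] := eB _ By.
by rewrite cmapK//; have [_ ->] := Vg _ Vy.
Qed.

Lemma box_coord_continuous psi y0 e N th y : flowbox psi y0 e N th -> N y ->
  {for y, continuous (fun y => psi (p y))}.
Proof.
move=> box Ny; apply: (for_continuous_comp (covering_continuous pcov (x:=y))).
exact: cmap_continuous (box_dom box Ny).
Qed.

Lemma box_nbhs psi y0 e N th y : flowbox psi y0 e N th -> N y -> nbhs y N.
Proof. by move=> box Ny; apply: open_nbhs_nbhs; split=> //; exact: box_open box. Qed.

Lemma box_projE psi y0 e N th v : flowbox psi y0 e N th ->
  ball (psi (p y0)) e v -> p (th v) = cinv psi v.
Proof.
move=> box vB; rewrite -[in RHS](box_invK box vB) cmapK//.
exact: (box_dom box (box_img box vB)).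
Qed.

Lemma box_cimg psi y0 e N th v : flowbox psi y0 e N th ->
  ball (psi (p y0)) e v -> cimg psi v.
Proof.
move=> box vB; rewrite -(box_invK box vB).
exact/cmap_img/(box_dom box)/(box_img box).
Qed.

Lemma locally_injective (y : Y) : exists2 V, nbhs y V &
  forall z z', V z -> V z' -> p z = p z' -> z = z'.
Proof.
have [U [_ Uy] /(_ y Uy)[V [g [oV Vy Vg _ _]]]] := evenly_covered pcov (p y).
exists V; first exact: open_nbhs_nbhs.
by move=> z z' /Vg[_ gz] /Vg[_ gz'] zz'; rewrite -gz zz'.
Qed.

(** Lifted leaves are the path components of the fibre product of [Y] and [leaf_space F] over
    [X]. *)
Lemma lifted_leafP x y : lifted_leaf F p x y <->
  joined R [set s : Y * leaf_space F | s.2 = p s.1] (x, p x) (y, p y).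
Proof.
split=> -[c [cc pc c0 c1]].
  exists (fun t => (c (clamp t), p (c (clamp t)))); split=> //.
  - move=> t; apply: for_continuous_pair; first exact: (clamp_path cc).
    exact: (clamp_path pc).
  - by rewrite clamp0 c0.
  - by rewrite clamp1 c1.
exists (fun t => (c t).1); split.
- apply: continuous_subspaceT => t.
  exact: (for_continuous_comp (cc t) (for_continuous_fst (x:=c t))).
- have -> : p \o (fun t => (c t).1) = (fun t => (c t).2 : X).
    by apply: funext => u; exact: esym (pc u).
  apply: continuous_subspaceT => t.
  exact: (for_continuous_comp (cc t) (for_continuous_snd (x:=c t))).
- by rewrite c0.
- by rewrite c1.
Qed.

Lemma lifted_leaf_path (c : R -> Y) : continuous c ->
  continuous (p \o c : R -> leaf_space F) -> lifted_leaf F p (c 0) (c 1).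
Proof. by move=> cc pc; exists c; split=> //; exact: continuous_subspaceT. Qed.

Lemma lifted_leaf_exists x y : lifted_leaf F p x y -> exists c : R -> Y,
  [/\ continuous c, continuous (p \o c : R -> leaf_space F), c 0 = x & c 1 = y].
Proof.
case=> c [cc pc c0 c1]; exists (c \o clamp); split.
- exact: clamp_path.
- exact: (clamp_path pc).
- by rewrite /= clamp0.
- by rewrite /= clamp1.
Qed.

Lemma lifted_leaf_refl x : lifted_leaf F p x x.
Proof. exact/lifted_leafP/joined_refl. Qed.

Lemma lifted_leaf_sym x y : lifted_leaf F p x y -> lifted_leaf F p y x.
Proof. by move=> /lifted_leafP xy; apply/lifted_leafP/joined_sym. Qed.

Lemma lifted_leaf_trans x y z :
  lifted_leaf F p x y -> lifted_leaf F p y z -> lifted_leaf F p x z.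
Proof.
by move=> /lifted_leafP xy /lifted_leafP yz; apply/lifted_leafP/(joined_trans xy yz).
Qed.

Lemma lifted_leaf_proj x y : lifted_leaf F p x y -> leaf F (p x) (p y).
Proof. by case=> c [cc pc <- <-]; exists (p \o c). Qed.

Lemma leafwise_path_lifting (c : R -> X) x :
  continuous (c : R -> leaf_space F) -> p x = c 0 -> exists c' : R -> Y,
  [/\ continuous c', c' 0 = x, forall t, 0 <= t <= 1 -> p (c' t) = c t &
    lifted_leaf F p x (c' 1)].
Proof.
move=> lc xc.
have [c' [cc' c'0 pc']] :=
  path_lifting pcov (fun t => leaf_continuous_continuous (lc t)) xc.
exists c'; split=> //; exists c'; split=> //; first exact: continuous_subspaceT.
apply: (@subspace_eq_continuous R `[0, 1]%classic (leaf_space F) c).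
  by move=> t; rewrite inE /= in_itv /= => /pc'.
exact: continuous_subspaceT.
Qed.

Lemma leaf_lift x y : leaf F (p x) y -> exists2 z, lifted_leaf F p x z & p z = y.
Proof.
move=> /leafP[c [lc _ c0 c1]].
have [c' [_ _ pc' xc']] := leafwise_path_lifting lc (esym c0).
by exists (c' 1) => //; rewrite pc' ?ler01 ?lexx.
Qed.

(** A continuous family of leafwise paths, one from each point of the open set [U]: the holonomy of
    the lifted foliation before any transversal is chosen. *)
Record transport (U : set Y) (H : Y * R -> Y) : Prop := Transport {
  transport_open : open U ;
  transport_continuous : forall y t, U y -> {for (y, t), continuous H} ;
  transport0 : forall y, U y -> H (y, 0) = y ;
  transport_leaf : forall y, U y ->
    continuous (fun t => p (H (y, t)) : leaf_space F) }.

Lemma transport_continuous1 U H y t : transport U H -> U y ->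
  {for y, continuous (fun y => H (y, t))}.
Proof.
move=> tr Uy.
exact: (for_continuous_comp (@for_continuous_pairl Y R y t) (transport_continuous tr Uy)).
Qed.

Lemma transport_continuous2 U H y : transport U H -> U y ->
  continuous (fun t => H (y, t)).
Proof.
move=> tr Uy t.
exact: (for_continuous_comp (@for_continuous_pairr Y R y t) (transport_continuous tr Uy)).
Qed.

Lemma transport_lifted_leaf U H y : transport U H -> U y ->
  lifted_leaf F p y (H (y, 1)).
Proof.
move=> tr Uy; rewrite -{1}(transport0 tr Uy).
exact: (lifted_leaf_path (transport_continuous2 tr Uy) (transport_leaf tr Uy)).
Qed.

Lemma transport_concat U1 H1 U2 H2 : transport U1 H1 -> transport U2 H2 ->
  transport [set y | U1 y /\ U2 (H1 (y, 1))]
    (concat H1 (fun s => H2 (H1 (s.1, 1), s.2))).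
Proof.
move=> tr1 tr2; split.
- rewrite openE => y [Uy1 Uy2].
  have nU2 : nbhs (H1 (y, 1)) U2.
    by apply: open_nbhs_nbhs; split=> //; exact: transport_open tr2.
  have nU1 : nbhs y U1 by apply: open_nbhs_nbhs; split=> //; exact: transport_open tr1.
  have := for_continuous_nbhs (transport_continuous1 (t := 1) tr1 Uy1) nU2.
  exact: filterI.
- move=> y t [Uy1 Uy2]; apply: concat_continuous => [u|u|].
  + exact: (transport_continuous tr1 Uy1).
  + have cy : {for (y, u), continuous (fun s : Y * R => H1 (s.1, 1))}.
      apply: (@for_continuous_comp _ _ _ fst (fun y => H1 (y, 1))).
        exact: for_continuous_fst.
      exact: transport_continuous1 tr1 Uy1.
    have cs := for_continuous_pair cy (for_continuous_snd (x := (y, u))).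
    exact: (for_continuous_comp cs (transport_continuous tr2 Uy2)).
  + by rewrite (transport0 tr2).
- by move=> y [Uy1 _]; rewrite concat0 (transport0 tr1).
- move=> y [Uy1 Uy2].
  have := concat_path_continuous (transport_leaf tr1 Uy1) (transport_leaf tr2 Uy2).
  rewrite (transport0 tr2)// => /(_ erefl) ct t.
  suff -> : (fun t => p (concat H1 (fun s => H2 (H1 (s.1, 1), s.2)) (y, t))) =
      (fun t => concat (fun s => p (H1 (y, s.2)))
        (fun s => p (H2 (H1 (y, 1), s.2))) (0 : R, t)) by exact: ct.
  by apply: funext => u; rewrite /concat /=; case: ifP.
Qed.

(** Each point of the box moves along a segment of its plaque to the slice of first coordinate [a];
    the path stays in the box because balls are convex. *)
Lemma slide psi y0 e N th a : fcharts F psi -> flowbox psi y0 e N th ->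
  ball (psi (p y0)).1 e a -> exists2 S, transport N S &
    forall y, N y -> S (y, 1) = th (a, (psi (p y)).2) /\
      forall t, N (S (y, t)) /\ (psi (p (S (y, t)))).2 = (psi (p y)).2.
Proof.
move=> Fpsi box aB; have bB y : N y -> ball (psi (p y0)).2 e (psi (p y)).2.
  by move=> /(box_ball box)[].
pose path y t := ((1 - clamp t) *: (psi (p y)).1 + clamp t *: a, (psi (p y)).2).
have pathB y t : N y -> ball (psi (p y0)) e (path y t).
  move=> Ny; split; last exact: bB.
  apply: ball_segment => //; last exact: clamp_itv.
  by have [] := box_ball box Ny.
pose S s := th (path s.1 s.2).
have cS y t : N y -> {for (y, t), continuous S}.
  move=> Ny.
  suff cpath : {for (y, t), continuous (fun s : Y * R => path s.1 s.2)}.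
    exact: (for_continuous_comp cpath (box_continuous box (pathB y t Ny))).
  have cy : {for (y, t), continuous (fun s : Y * R => psi (p s.1))}.
    apply: (@for_continuous_comp _ _ _ fst (fun y => psi (p y))).
      exact: for_continuous_fst.
    exact: box_coord_continuous box Ny.
  have ct : {for (y, t), continuous (fun s : Y * R => clamp s.2)}.
    apply: (@for_continuous_comp _ _ _ snd clamp).
      exact: for_continuous_snd.
    exact: clamp_continuous.
  apply: for_continuous_pair; last first.
    exact: (for_continuous_comp cy (for_continuous_snd (x := _))).
  apply: for_continuousD.
    apply: (@continuousZ _ _ _ (fun s : Y * R => 1 - clamp s.2)
      (fun s => (psi (p s.1)).1)).
      by apply: for_continuousB => //; exact: cst_continuous.
    exact: (for_continuous_comp cy (for_continuous_fst (x := _))).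
  apply: (@continuousZ _ _ _ (fun s : Y * R => clamp s.2) (fun=> a)) => //.
  exact: cst_continuous.
exists S; first split.
- exact: box_open box.
- exact: cS.
- move=> y Ny; rewrite /S /path /= clamp0 subr0 scale1r scale0r addr0.
  by rewrite -surjective_pairing (boxK box).
- move=> y Ny t.
  have NS u : N (S (y, u)) := box_img box (pathB y u Ny).
  apply/(leaf_continuousP (f := fun t => p (S (y, t))) Fpsi (box_dom box (NS t))).
  split; last first.
    apply: (nbhs_sub (A := setT)); first exact: filterT.
    by move=> u _; rewrite /S /= !(box_invK box) //; exact: pathB.
  apply: (@for_continuous_comp _ _ _ (fun t => S (y, t)) p); last first.
    exact: covering_continuous.
  exact: (for_continuous_comp (@for_continuous_pairr Y R y t) (cS y t Ny)).
- move=> y Ny; split; first by rewrite /S /path /= clamp1 subrr scale0r scale1r add0r.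
  move=> t; split; first exact: (box_img box (pathB y t Ny)).
  by rewrite (box_invK box (pathB y t Ny)).
Qed.

Lemma box_transport psi y0 e N th y z : fcharts F psi -> flowbox psi y0 e N th ->
  N y -> N z -> (psi (p y)).2 = (psi (p z)).2 ->
  exists2 S, transport N S & S (y, 1) = z /\
    forall t, N (S (y, t)) /\ (psi (p (S (y, t)))).2 = (psi (p y)).2.
Proof.
move=> Fpsi box Ny Nz yz; have [|S trS S1] := slide (a := (psi (p z)).1) Fpsi box.
  by have [] := box_ball box Nz.
have [S1y Sy] := S1 y Ny; exists S => //; split=> //.
by rewrite S1y yz -surjective_pairing (boxK box).
Qed.

Lemma box_lifted_leaf psi y0 e N th y z : fcharts F psi ->
  flowbox psi y0 e N th -> N y -> N z -> (psi (p y)).2 = (psi (p z)).2 ->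
  lifted_leaf F p y z.
Proof.
move=> Fpsi box Ny Nz yz; have [S trS [<- _]] := box_transport Fpsi box Ny Nz yz.
exact: (transport_lifted_leaf trS Ny).
Qed.

(** Continuation along a leafwise path from [x] to [y]: a transport ending in a flow box is
    prolonged by a slide between two points of the same plaque. Slides go both ways in time, which
    makes the property locally constant. *)
Lemma transport_exists x y : lifted_leaf F p x y ->
  exists U, exists2 H, transport U H & U x /\ H (x, 1) = y.
Proof.
move=> /lifted_leaf_exists[c [cc pc c0 <-]].
pose P t := exists U, exists2 H, transport U H & U x /\ H (x, 1) = c t.
apply: (@locally_constant _ P _ 0) => [t|]; last first.
  have [psi Fpsi psix] := fcharts_cover F (p x).
  have [e [N [th box _]]] := flowbox_exists psix filterT.
  have Nx := box_center box.
  have [S trS [S1 _]] := box_transport Fpsi box Nx Nx erefl.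
  by exists N, S => //; rewrite c0.
have [psi Fpsi psit] := fcharts_cover F (p (c t)).
have [e [N [th box _]]] := flowbox_exists psit filterT.
have Nt := box_center box.
have [_ et] := (leaf_continuousP (f := p \o c) Fpsi psit).1 (pc t).
have step u v : N (c u) -> N (c v) -> (psi (p (c u))).2 = (psi (p (c v))).2 ->
    P u -> P v.
  move=> Nu Nv uv [U [H trH [Ux Hx]]].
  have [S trS [S1 _]] := box_transport Fpsi box Nu Nv uv.
  exists [set y | U y /\ N (H (y, 1))].
  exists (concat H (fun s => S (H (s.1, 1), s.2))); first exact: transport_concat.
  by rewrite /= concat1 /= Hx.
apply: filterS2 et (for_continuous_nbhs (cc t) (box_nbhs box Nt)) => s es Ns.
by split; apply: step.
Qed.

End Lifts.

(** * Scalar products in coordinates *)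

Lemma for_continuous_sum (R : realType) (S : topologicalType) (V : normedModType R)
    (I : Type) (r : seq I) (f : I -> S -> V) x :
  (forall i, {for x, continuous (f i)}) ->
  {for x, continuous (fun s => \sum_(i <- r) f i s)}.
Proof.
move=> cf; elim: r => [|i r IH].
  suff -> : (fun s => \sum_(i <- [::]) f i s) = fun=> 0 by exact: cst_continuous.
  by apply: funext => s; rewrite big_nil.
suff -> : (fun s => \sum_(j <- i :: r) f j s) =
  fun s => f i s + \sum_(j <- r) f j s by exact: for_continuousD.
by apply: funext => s; rewrite big_cons.
Qed.

Section Dot.
Context {R : realType} {d : nat}.
Implicit Types (u v w : 'rV[R]_d).

(** The norm of ['rV[R]_d] is the sup norm, which is not differentiable; the distances to be
    minimised are measured by this product. *)
Definition dot v w := \sum_(i < d) v ord0 i * w ord0 i.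

Lemma dot0 w : dot 0 w = 0.
Proof. by rewrite /dot big1// => i _; rewrite mxE mul0r. Qed.

Lemma dotN v w : dot (- v) w = - dot v w.
Proof. by rewrite /dot -sumrN; apply: eq_bigr => i _; rewrite mxE mulNr. Qed.

Lemma dotDr u v w : dot u (v + w) = dot u v + dot u w.
Proof. by rewrite /dot -big_split /=; apply: eq_bigr => i _; rewrite mxE mulrDr. Qed.

Lemma sqN v : dot (- v) (- v) = dot v v.
Proof. by rewrite /dot; apply: eq_bigr => i _; rewrite !mxE mulrNN. Qed.

Lemma sq_ge0 v : 0 <= dot v v.
Proof. by rewrite /dot; apply: sumr_ge0 => i _; rewrite -expr2 sqr_ge0. Qed.

Lemma sq_eq0 v : dot v v = 0 -> v = 0.
Proof.
move=> v0; apply/rowP => i; rewrite mxE.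
have/psumr_eq0P h : forall i, true -> 0 <= v ord0 i * v ord0 i.
  by move=> j _; rewrite -expr2 sqr_ge0.
by have /eqP := h v0 i erefl; rewrite mulf_eq0 => /orP[]/eqP.
Qed.

Lemma sq_continuous : continuous (fun v => dot v v).
Proof.
move=> v; apply: for_continuous_sum => i.
by apply: for_continuousM; exact: coord_continuous.
Qed.

Lemma sq_is_derive (f : R -> 'rV[R]_d) (t : R) df : is_derive t (1 : R) f df ->
  is_derive t (1 : R) (fun t => dot (f t) (f t)) (2 * dot (f t) df).
Proof.
move=> [fd fdf].
have fi i : is_derive t (1 : R) (fun t => f t ord0 i) (df ord0 i).
  split; first by have /derivable_mxP := fd; apply.
  by rewrite -fdf derive_mx// mxE.
rewrite (_ : (fun t => _) = \sum_i (fun t => f t ord0 i * f t ord0 i)); last first.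
  by apply: funext => u; rewrite fct_sumE.
apply: is_derive_eq; rewrite /dot mulr_sumr; apply: eq_bigr => i _.
by rewrite /GRing.scale /=; ring.
Qed.

(** The derivative of the squared length, twice the product of [f] with its derivative, vanishes at
    an interior minimum. *)
Lemma sq_min (f : R -> 'rV[R]_d) df (e : R) : 0 < e ->
  (forall t : R, `|t| < e -> derivable f t (1 : R)) ->
  (forall t : R, `|t| < e -> dot (f 0) (f 0) <= dot (f t) (f t)) ->
  is_derive (0 : R) (1 : R) f df -> dot (f 0) df = 0.
Proof.
move=> e0 fd fmin f0.
have [|t te|||_ h] := @derive1_at_min R (fun t => dot (f t) (f t)) (- e) e 0.
- lra.
- apply: (@ex_derive _ _ _ _ _ _ _ (sq_is_derive _)); apply: derivableP.
  by apply: fd; rewrite ltr_norml; rewrite in_itv in te.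
- by rewrite in_itv /= oppr_lt0 e0.
- by move=> t te; apply: fmin; rewrite ltr_norml; rewrite in_itv in te.
have [_ h'] := sq_is_derive f0; move: h'; rewrite h => /esym/eqP.
by rewrite mulf_eq0 pnatr_eq0 /= => /eqP.
Qed.

(* v_j is the scalar product of v and delta_j - x_j, hence the sum S of the |v_j|
   satisfies S <= d / (d + 1) S. *)
Lemma orthogonal_basis_near v (x : 'I_d -> 'rV[R]_d) :
  (forall j i, `|(delta_mx ord0 j : 'rV[R]_d) ord0 i - x j ord0 i| < d.+1%:R^-1) ->
  (forall j, dot v (x j) = 0) -> v = 0.
Proof.
move=> xb xv; pose S := \sum_i `|v ord0 i|.
have vj j : `|v ord0 j| <= d.+1%:R^-1 * S.
  have -> : v ord0 j = dot v ((delta_mx ord0 j : 'rV[R]_d) - x j).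
    rewrite dotDr.
    have -> : dot v (- x j) = 0.
      rewrite -[RHS]oppr0 -(xv j) /dot -sumrN; apply: eq_bigr => i _.
      by rewrite mxE mulrN.
    rewrite addr0 /dot (bigD1 j)//= big1 => [|i ij].
      by rewrite mxE !eqxx mulr1 addr0.
    by rewrite mxE eqxx (negPf ij) mulr0.
  rewrite /S mulr_sumr; apply: le_trans (ler_norm_sum _ _ _) _.
  apply: ler_sum => i _; rewrite normrM mulrC ler_wpM2r//.
  by rewrite !mxE; apply: ltW; have := xb j i; rewrite mxE.
have S0 : S <= d%:R / d.+1%:R * S.
  rewrite {1}/S (le_trans (ler_sum _ (fun i _ => vj i)))//.
  by rewrite sumr_const card_ord -[leLHS]mulr_natl mulrA.
have Sge : 0 <= S by apply: sumr_ge0.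
have {}S0 : S = 0.
  apply/eqP; rewrite eq_le Sge andbT; move: S0.
  rewrite -subr_le0 -{1}[S]mul1r -mulrBl.
  rewrite pmulr_rle0// subr_gt0 ltr_pdivrMr ?ltr0n// mul1r ltr_nat//.
apply/rowP => i; rewrite mxE; apply/normr0_eq0.
exact: (psumr_eq0P (fun i _ => normr_ge0 (v ord0 i)) S0).
Qed.

End Dot.

(** * Tangent bundles of the leaves *)

Lemma line_is_diff (R : realType) n (a u : 'rV[R]_n) (t : R) :
  is_diff t (fun t => a + t *: u) (fun t => t *: u).
Proof.
apply: (@is_diff_eq _ _ _ _ (fun t : R => 0 + t *: u)).
by apply: funext => h; rewrite add0r.
Qed.

Lemma line_continuous (R : realType) n (a u : 'rV[R]_n) (t : R) :
  {for t, continuous (fun t : R => a + t *: u)}.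
Proof. by have [h _] := line_is_diff a u t; exact: differentiable_continuous. Qed.

Section Tangency.
Context {R : realType} {d : nat} {M : manifold R d}.
Implicit Types (E : M -> {vspace 'rV[R]_d}) (w z : M).

Lemma chart_change_differentiable w z : cdom (chart w) z ->
  differentiable (chart w \o cinv (chart z)) (chart z z).
Proof.
move=> wz; have [h _] := chart_smooth z w 1; apply: h; split.
  exact/cmap_img/chart_dom.
by rewrite cmapK//; exact: chart_dom.
Qed.

Lemma tcoordxx w v : tcoord w w v = v.
Proof.
rewrite /tcoord -deriveE; last exact/chart_change_differentiable/chart_dom.
have h : \forall u \near chart w w, (chart w \o cinv (chart w)) u = id u.
  by apply: filterS (cimg_nbhs (cmap_img (chart_dom w))) => u; exact: cinvK.
by rewrite (near_eq_derive _ h) derive_id.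
Qed.

(** Every vector of the fibre at [w] extends to a section continuous at [w]. Unlike the existence of
    local bases, this passes directly to sums of bundles, such as center stable ones. *)
Definition has_sections E w := forall v, v \in E w ->
  exists s : M -> 'rV[R]_d, [/\ \forall z \near w, s z \in E z,
    {for w, continuous (fun z => tcoord w z (s z))} & s w = v].

Lemma continuous_subbundle_sections r E w :
  continuous_subbundle r E -> has_sections E w.
Proof.
move=> /(_ w)[e eE] v vE.
have [eb ec] := nbhs_singleton eE.
have [c vc] : exists c : 'I_r -> R, v = \sum_i c i *: e i w.
  have := coord_basis eb vE => ->.
  exists (fun i => coord [tuple e i w | i < r] i v); apply: eq_bigr => i _.
  by rewrite -tnth_nth tnth_mktuple.
exists (fun z => \sum_i c i *: e i z); split=> //.
  apply: filterS eE => z [zb _]; apply: rpred_sum => i _; apply: rpredZ.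
  rewrite -(span_basis zb); apply: memv_span.
  by apply/tnthP; exists i; rewrite tnth_mktuple.
suff -> : (fun z => tcoord w z (\sum_i c i *: e i z)) =
    fun z => \sum_i c i *: tcoord w z (e i z).
  apply: for_continuous_sum => i.
  apply: (@continuousZ _ _ _ (fun=> c i)); [exact: cst_continuous|exact: ec].
by apply: funext => z; rewrite /tcoord linear_sum; apply: eq_bigr => i _; rewrite linearZ.
Qed.

Lemma has_sectionsD E E' w : has_sections E w -> has_sections E' w ->
  has_sections (fun z => E z + E' z)%VS w.
Proof.
move=> hE hE' v /memv_addP[v1 v1E [v2 v2E ->]].
have [s1 [s1E s1c s1w]] := hE _ v1E; have [s2 [s2E s2c s2w]] := hE' _ v2E.
exists (fun z => s1 z + s2 z); split; last by rewrite s1w s2w.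
  by apply: filterS2 s1E s2E => z s1z s2z; exact: memv_add.
suff -> : (fun z => tcoord w z (s1 z + s2 z)) =
  fun z => tcoord w z (s1 z) + tcoord w z (s2 z) by exact: for_continuousD.
by apply: funext => z; rewrite /tcoord linearD.
Qed.

(** Each standard basis vector is a sum of vectors of the two fibres at [w]. Extended by sections,
    these sums stay close to the basis, and [orthogonal_basis_near] applies. The base points [z] and
    [z'] are independent, since they will be the closest points of two different plaques. *)
Lemma transverse_near E E' w : has_sections E w -> has_sections E' w ->
  (E w + E' w)%VS = fullv ->
  exists2 W, nbhs w W & forall z z' v, W z -> W z' ->
    (forall x, x \in E z -> dot v (tcoord w z x) = 0) ->
    (forall x, x \in E' z' -> dot v (tcoord w z' x) = 0) -> v = 0.
Proof.
move=> hE hE' EE'.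
have h j : exists s s' : M -> 'rV[R]_d,
    [/\ s w + s' w = delta_mx ord0 j,
      \forall z \near w, s z \in E z, \forall z \near w, s' z \in E' z,
      {for w, continuous (fun z => tcoord w z (s z))} &
      {for w, continuous (fun z => tcoord w z (s' z))}].
  have : (delta_mx ord0 j : 'rV[R]_d) \in (E w + E' w)%VS by rewrite EE' memvf.
  move=> /memv_addP[v vE [v' v'E ->]].
  have [s [sE sc sw]] := hE _ vE; have [s' [s'E s'c s'w]] := hE' _ v'E.
  by exists s, s'; rewrite sw s'w.
(* Half of the tolerance of [orthogonal_basis_near], one half for each of the two sections. *)
pose ep : R := d.+1%:R^-1 / 2; have ep0 : 0 < ep by rewrite divr_gt0// invr_gt0 ltr0n.
pose good j s s' z := [/\ s z \in E z, s' z \in E' z,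
    ball (s w) ep (tcoord w z (s z)) & ball (s' w) ep (tcoord w z (s' z))] /\
    s w + s' w = delta_mx ord0 j :> 'rV[R]_d.
have {}h j : exists s s', \forall z \near w, good j s s' z.
  have [s [s' [sj sE s'E sc s'c]]] := h j; exists s, s'.
  have nb (t : M -> 'rV[R]_d) : {for w, continuous (fun z => tcoord w z (t z))} ->
      \forall z \near w, ball (t w) ep (tcoord w z (t z)).
    move=> tc; apply: (for_continuous_nbhs tc); rewrite tcoordxx.
    exact: nbhsx_ballx.
  apply: filterS2 (filterI sE s'E) (filterI (nb _ sc) (nb _ s'c)).
  by move=> z [? ?] [? ?].
have {}h j : exists s : (M -> 'rV[R]_d) * (M -> 'rV[R]_d),
    \forall z \near w, good j s.1 s.2 z.
  by have [s [s' ?]] := h j; exists (s, s').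
pose S j := sval (cid (h j)).
exists [set z | forall j, good j (S j).1 (S j).2 z].
  have := @filter_forall _ _ (fun j => good j (S j).1 (S j).2) (nbhs w) _.
  by apply=> j; rewrite /S; case: cid.
move=> z z' v zW z'W vE vE'.
apply: (orthogonal_basis_near
    (x := fun j => tcoord w z ((S j).1 z) + tcoord w z' ((S j).2 z'))) => [j i|j].
  have [[_ _ [_ b1] _] <-] := zW j; have [[_ _ _ [_ b2]] _] := z'W j.
  have {}b1 := b1 ord0 i; have {}b2 := b2 ord0 i.
  rewrite !mxE opprD addrACA.
  have -> : d.+1%:R^-1 = ep + ep :> R by rewrite /ep -splitr.
  exact: le_lt_trans (ler_normD _ _) (ltrD b1 b2).
by rewrite dotDr vE ?vE' ?addr0//; [have [[]] := z'W j|have [[]] := zW j].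
Qed.

Context {k q : nat}.
Variables (F : foliation R k q M) (E : M -> {vspace 'rV[R]_d}).
Hypothesis FE : tangent_foliation F E.

(** [tangent_foliation] reads a plaque in the chart indexed by its base point, which varies with
    [t]; the chain rule with a change of charts brings all the derivatives to the fixed chart of
    [w]. *)
Lemma plaque_is_derive psi a b u (t : R) w : fcharts F psi ->
  let z := cinv psi (a + t *: u, b) in
  ball 0 1 (a + t *: u, b) -> cdom (chart w) z ->
  is_derive t (1 : R) (fun t => chart w (cinv psi (a + t *: u, b)))
    (tcoord w z ('d (fun a' => chart z (cinv psi (a', b))) (a + t *: u) u)).
Proof.
move=> Fpsi z abB wz.
have [[U [oU Ua] [Ud _]] _ _] := FE Fpsi abB.
have d2 : is_diff (a + t *: u) (fun a' => chart z (cinv psi (a', b)))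
  ('d (fun a' => chart z (cinv psi (a', b))) (a + t *: u)).
  exact/differentiableP/Ud.
have d3 : is_diff (chart z (cinv psi (a + t *: u, b)))
    (chart w \o cinv (chart z)) (tcoord w z).
  exact/differentiableP/chart_change_differentiable.
have d1 := line_is_diff a u t.
have dc := is_diff_comp d1 (is_diff_comp d2 d3).
have z_near : \forall t \near t, cdom (chart z) (cinv psi (a + t *: u, b)).
  apply: (@for_continuous_nbhs _ _ (fun t : R => cinv psi (a + t *: u, b))).
    apply: (@for_continuous_comp _ _ _ (fun t : R => (a + t *: u, b)) (cinv psi)).
      apply: for_continuous_pair; last exact: cst_continuous.
      exact: line_continuous.
    by apply: cinv_continuous; rewrite (fcharts_cube Fpsi).
  exact/cdom_nbhs/chart_dom.
apply: (near_eq_is_derive (f := (chart w \o cinv (chart z)) \o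
  (fun a' => chart z (cinv psi (a', b))) \o (fun t : R => a + t *: u))).
  by apply: filterS z_near => s zs; rewrite /= cmapK.
have [fd fdE] := dc; split; first exact: diff_derivable.
by rewrite deriveE// fdE /= scale1r.
Qed.

(* First-order optimality of the squared distance from c to the plaque, in the chart
   at w. *)
Lemma plaque_critical psi a b w c : fcharts F psi ->
  (\forall a' \near a, [/\ ball 0 1 (a', b), cdom (chart w) (cinv psi (a', b)) &
    let g a := chart w (cinv psi (a, b)) - c in dot (g a) (g a) <= dot (g a') (g a')]) ->
  let z := cinv psi (a, b) in
  forall x, x \in E z -> dot (chart w z - c) (tcoord w z x) = 0.
Proof.
move=> Fpsi near_a z x xE.
have [aB wz _] := nbhs_singleton near_a.
have [_ _] := FE Fpsi aB.
have : [set` E z] x by [].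
move=> /[swap] <- [u _ <-].
have line := line_continuous (a := a) (u := u) (t := 0).
have near_0 := for_continuous_nbhs line; move: near_0.
rewrite scale0r addr0 => /(_ _ near_a)/nbhs_ballP[e /= e0 eB].
have {}eB t : `|t| < e -> [/\ ball 0 1 (a + t *: u, b),
    cdom (chart w) (cinv psi (a + t *: u, b)) &
    let g a := chart w (cinv psi (a, b)) - c in
    dot (g a) (g a) <= dot (g (a + t *: u)) (g (a + t *: u))].
  by move=> te; apply: eB; rewrite -ball_normE /= sub0r normrN.
have der t : `|t| < e -> is_derive t (1 : R)
    (fun t => chart w (cinv psi (a + t *: u, b)) - c)
    (tcoord w (cinv psi (a + t *: u, b))
      ('d (fun a' => chart (cinv psi (a + t *: u, b)) (cinv psi (a', b)))
        (a + t *: u) u)).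
  move=> te; have [tB tw _] := eB t te.
  have dt := plaque_is_derive Fpsi tB tw.
  rewrite -[X in is_derive _ _ _ X]subr0.
  exact: (is_deriveB dt (is_derive_cst c t 1)).
have h0 : `|0 : R| < e by rewrite normr0.
have := der 0 h0; rewrite scale0r addr0 => d0.
have := @sq_min _ _ (fun t => chart w (cinv psi (a + t *: u, b)) - c) _ e e0 _ _ d0.
rewrite scale0r addr0; apply.
  by move=> t /der [].
by move=> t /eB [].
Qed.

End Tangency.

(** * Local product structure *)

Lemma closed_ball_row_compact (R : realType) n (a : 'rV[R]_n) (r : R) :
  compact [set x | `|a - x| <= r].
Proof.
apply: bounded_closed_compact.
  exists (`|a| + r); split; first exact: num_real.
  move=> s sr x /= xr; apply: le_trans (ltW sr).
  by rewrite -[x](subKr a) (le_trans (ler_normB _ _))// lerD2l.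
exact: (@closed_closed_ball_ R 'rV[R]_n a r).
Qed.

Section LocalProduct.
Context {R : realType} {d : nat} {M : manifold R d} {k q l r : nat}.
Variables (F : foliation R k q M) (G : foliation R l r M).
Variables (EF EG : M -> {vspace 'rV[R]_d}).
Hypothesis FEF : tangent_foliation F EF.
Hypothesis GEG : tangent_foliation G EG.
Context {Y : topologicalType}.
Variable p : Y -> M.
Hypothesis pcov : covering_map p.

(* If the leaves of F and G through w0 only meet at w0, then the minimum of the
   squared distance between the plaque of F through e and the plaque of G through
   w0 is interior as soon as e is close to w0; by transversality it vanishes. *)
Theorem local_product w0 (W : set Y) : nbhs w0 W ->
  has_sections EF (p w0) -> has_sections EG (p w0) ->
  (EF (p w0) + EG (p w0))%VS = fullv ->
  (forall z, lifted_leaf F p w0 z -> lifted_leaf G p w0 z -> z = w0) ->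
  \forall e \near w0, exists2 z, W z &
    lifted_leaf F p e z /\ lifted_leaf G p w0 z.
Proof.
move=> nW secF secG EE uniq; pose w := p w0; pose phi := chart w.
have [W1 nW1 tr] := transverse_near secF secG EE.
have [V nV Vinj] := locally_injective pcov w0.
pose W' := [set y | [/\ W y, V y, W1 (p y) & cdom phi (p y)]].
have nW' : nbhs w0 W'.
  have cp := covering_continuous pcov (x := w0).
  have nD := for_continuous_nbhs cp (cdom_nbhs (chart_dom w)).
  apply: filterS2 (filterI nW nV) (filterI (for_continuous_nbhs cp nW1) nD).
  by move=> y [? ?] [? ?].
have [psiF FpsiF psiFw] := fcharts_cover F w.
have [eF [NF [thF boxF NFW]]] := flowbox_exists pcov psiFw nW'.
have [psiG GpsiG psiGw] := fcharts_cover G w.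
have [eG [NG [thG boxG NGW]]] := flowbox_exists pcov psiGw nW'.
have eF0 := box_gt0 boxF; have eG0 := box_gt0 boxG.
set a0 := (psiF w).1; set b0 := (psiF w).2.
set a1 := (psiG w).1; set b1 := (psiG w).2.
(* Closed balls of radius [rho] are compact and still lie inside both flow boxes. *)
pose rho := Num.min eF eG / 2.
have rho0 : 0 < rho by rewrite divr_gt0// lt_min eF0.
have rhoF : rho < eF by rewrite /rho ltr_pdivrMr// gt_min; apply/orP; left; lra.
have rhoG : rho < eG by rewrite /rho ltr_pdivrMr// gt_min; apply/orP; right; lra.
pose K : set ('rV[R]_k * 'rV[R]_l) :=
  [set x | `|a0 - x| <= rho] `*` [set x | `|a1 - x| <= rho].
have cK : compact K by apply: compact_setX; exact: closed_ball_row_compact.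
have KF ka e : K ka -> NF e -> ball (psiF w) eF (ka.1, (psiF (p e)).2).
  move=> [ka1 _] /(box_ball boxF)[_ eB]; split => //=.
  by rewrite -ball_normE /=; exact: le_lt_trans ka1 rhoF.
have KG ka : K ka -> ball (psiG w) eG (ka.2, b1).
  move=> [_ ka2]; split => /=; last exact: ballxx.
  by rewrite -ball_normE /=; exact: le_lt_trans ka2 rhoG.
(* Difference, in the chart at [w], between a point of the plaque of [F] through [e] and a point of
   the plaque of [G] through [w0]. *)
pose A (ka : 'rV[R]_k * 'rV[R]_l) (e : Y) :=
  phi (p (thF (ka.1, (psiF (p e)).2))) - phi (p (thG (ka.2, b1))).
have domF y : NF y -> cdom phi (p y) by move=> /NFW[].
have domG y : NG y -> cdom phi (p y) by move=> /NGW[].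
have cphi (S : topologicalType) (f : S -> Y) s : {for s, continuous f} ->
    cdom phi (p (f s)) -> {for s, continuous (fun s => phi (p (f s)))}.
  move=> cf fD; apply: (@for_continuous_comp _ _ _ (fun s => p (f s)) phi).
    exact: (for_continuous_comp cf (covering_continuous pcov (x := f s))).
  exact: cmap_continuous.
have cA (S : topologicalType) (f : S -> 'rV[R]_k) (g : S -> 'rV[R]_l) (h : S -> Y) s :
    {for s, continuous f} -> {for s, continuous g} -> {for s, continuous h} ->
    K (f s, g s) -> NF (h s) -> {for s, continuous (fun s => A (f s, g s) (h s))}.
  move=> cf cg ch Ks Ns; apply: for_continuousB.
    apply: (cphi _ (fun s => thF (f s, (psiF (p (h s))).2))); last first.
      exact/domF/(box_img boxF)/(KF (f s, g s)).
    apply: (@for_continuous_comp _ _ _ (fun s => (f s, (psiF (p (h s))).2)) thF).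
      apply: for_continuous_pair; first exact: cf.
      have cs := for_continuous_comp ch (box_coord_continuous pcov boxF Ns).
      exact: (for_continuous_comp cs (for_continuous_snd (x := _))).
    exact/(box_continuous boxF)/(KF (f s, g s)).
  apply: (cphi _ (fun s => thG (g s, b1))); last first.
    exact/domG/(box_img boxG)/(KG (f s, g s)).
  apply: (@for_continuous_comp _ _ _ (fun s => (g s, b1)) thG).
    by apply: for_continuous_pair; [exact: cg|exact: cst_continuous].
  exact/(box_continuous boxG)/(KG (f s, g s)).
have A0 ka e : K ka -> NF e -> A ka e = 0 ->
    thF (ka.1, (psiF (p e)).2) = thG (ka.2, b1).
  move=> Kka Ne /eqP; rewrite subr_eq0 => /eqP Aeq.
  have /NFW[_ V1 _ D1] := box_img boxF (KF ka e Kka Ne).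
  have /NGW[_ V2 _ D2] := box_img boxG (KG ka Kka).
  by apply: Vinj => //; rewrite -(cmapK D1) -(cmapK D2) -/phi Aeq.
have leafF ka e : K ka -> NF e -> lifted_leaf F p e (thF (ka.1, (psiF (p e)).2)).
  move=> Kka Ne; have B := KF ka e Kka Ne.
  apply: (box_lifted_leaf pcov FpsiF boxF) => //; first exact: (box_img boxF B).
  by rewrite (box_invK boxF B).
have leafG ka : K ka -> lifted_leaf G p w0 (thG (ka.2, b1)).
  move=> Kka; have B := KG ka Kka.
  apply: (box_lifted_leaf pcov GpsiG boxG); first exact: (box_center boxG).
    exact: (box_img boxG B).
  by rewrite (box_invK boxG B).
have Nw0 := box_center boxF.
have Kr ka : ball a0 rho ka.1 -> ball a1 rho ka.2 -> K ka.
  by rewrite -!ball_normE; split; exact: ltW.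
(* Competitor for the minimum: it selects the points [e] and [w0] themselves, whose distance tends
   to zero as [e] approaches [w0]. *)
pose ke e : 'rV[R]_k * 'rV[R]_l := ((psiF (p e)).1, a1).
have Kw0 : K (ke w0) by apply: Kr; exact: ballxx.
have Aw0 : A (ke w0) w0 = 0.
  rewrite /A /ke /= -surjective_pairing (boxK boxF)//.
  have -> : (a1, b1) = psiG (p w0) by rewrite [RHS]surjective_pairing.
  by rewrite (boxK boxG) ?subrr//; exact: (box_center boxG).
have A0w0 ka : K ka -> A ka w0 = 0 -> ka = (a0, a1).
  move=> Kka Aka; have e12 := A0 ka w0 Kka Nw0 Aka.
  have l1 := leafF ka w0 Kka Nw0; have l2 := leafG ka Kka.
  have e1 : thF (ka.1, (psiF (p w0)).2) = w0 by apply: uniq => //; rewrite e12.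
  have := box_invK boxF (KF ka w0 Kka Nw0); have := box_invK boxG (KG ka Kka).
  rewrite -e12 e1 => h1 h2.
  by rewrite (surjective_pairing ka) /a1 /a0 /w h1 h2.
(* [D] is the boundary of [K], where the minimum must not be attained. *)
pose D := K `&` [set ka | rho <= `|a0 - ka.1| \/ rho <= `|a1 - ka.2|].
have cD : compact D.
  apply: (compact_closedI cK); apply: closedU.
    apply: (preimage_closed (f := fun ka : 'rV[R]_k * 'rV[R]_l => `|a0 - ka.1|)
      (D := [set x | rho <= x])); last exact: closed_ge.
    move=> ka _; have c : {for ka, continuous
        (fun ka : 'rV[R]_k * 'rV[R]_l => a0 - ka.1)}.
      by apply: for_continuousB; [exact: cst_continuous|exact: for_continuous_fst].
    exact: (for_continuous_comp c (@norm_continuous _ 'rV[R]_k _)).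
  apply: (preimage_closed (f := fun ka : 'rV[R]_k * 'rV[R]_l => `|a1 - ka.2|)
    (D := [set x | rho <= x])); last exact: closed_ge.
  move=> ka _; have c : {for ka, continuous
      (fun ka : 'rV[R]_k * 'rV[R]_l => a1 - ka.2)}.
    by apply: for_continuousB; [exact: cst_continuous|exact: for_continuous_snd].
  exact: (for_continuous_comp c (@norm_continuous _ 'rV[R]_l _)).
have cke (S : topologicalType) (h : S -> Y) s : {for s, continuous h} ->
    h s = w0 -> {for s, continuous (fun s => (psiF (p (h s))).1)}.
  move=> ch hs; have Nhs : NF (h s) by rewrite hs.
  have cs := for_continuous_comp ch (box_coord_continuous pcov boxF Nhs).
  exact: (for_continuous_comp cs (for_continuous_fst (x := _))).
pose P e ka := dot (A (ke e) e) (A (ke e) e) < dot (A ka e) (A ka e).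
(* At [e = w0] the competitor gives zero, while [A] vanishes on [K] only at the centre, outside [D].
   The strict inequality extends to nearby [e] by continuity, uniformly over the compact [D]. *)
have near_D : \forall e \near w0, D `<=` P e.
  have /compact_near_coveringP := cD; apply => ka [Kka Dka].
  pose del (s : ('rV[R]_k * 'rV[R]_l) * Y) := dot (A s.1 s.2) (A s.1 s.2) -
    dot (A (ke s.2) s.2) (A (ke s.2) s.2).
  have cdel : {for (ka, w0), continuous del}.
    have c1 := for_continuous_fst (x := (ka, w0)).
    have c2 := for_continuous_snd (x := (ka, w0)).
    have c11 := for_continuous_comp c1 (for_continuous_fst (x := ka)).
    have c12 := for_continuous_comp c1 (for_continuous_snd (x := ka)).
    have cAs := cA _ (fun s : ('rV[R]_k * 'rV[R]_l) * Y => s.1.1) (fun s => s.1.2)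
      (fun s => s.2) (ka, w0) c11 c12 c2.
    rewrite /= -surjective_pairing in cAs.
    have ca1 : {for (ka, w0), continuous (fun=> a1)} by exact: cst_continuous.
    have cke' := cke _ (fun s : ('rV[R]_k * 'rV[R]_l) * Y => s.2) (ka, w0) c2 erefl.
    have cAk := cA _ _ _ (fun s => s.2) (ka, w0) cke' ca1 c2 Kw0 Nw0.
    apply: for_continuousB.
      exact: (for_continuous_comp (cAs Kka Nw0) (sq_continuous (x := _))).
    exact: (for_continuous_comp cAk (sq_continuous (x := _))).
  have del0 : 0 < del (ka, w0).
    rewrite /del /= Aw0 dot0 subr0 lt_neqAle sq_ge0 andbT eq_sym; apply/eqP.
    move=> /sq_eq0 /(A0w0 _ Kka) ka0; move: Dka; rewrite /= ka0 /= !subrr !normr0.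
    by rewrite leNgt rho0; case.
  have h : nbhs (ka, w0) [set s | P s.2 s.1].
    apply: nbhs_sub (for_continuous_nbhs cdel (lt_nbhsr del0)) _.
    by move=> s; rewrite /= /del subr_gt0.
  exact: h.
have near_N := box_nbhs boxF Nw0.
have near_r : \forall e \near w0, ball a0 rho (psiF (p e)).1.
  apply: (@for_continuous_nbhs _ _ (fun e => (psiF (p e)).1) _ (ball a0 rho)).
    exact: (cke _ id w0 (@cvg_id _ _) erefl).
  exact: nbhsx_ballx.
apply: filterS3 near_D near_N near_r => e DP Ne re.
have Ke : K (ke e) by apply: Kr => //; exact: ballxx.
have [ka Kka kamin] : exists2 ka, K ka &
    forall ka', K ka' -> dot (A ka e) (A ka e) <= dot (A ka' e) (A ka' e).
  have [|ka /set_mem Kka kamin] := compact_EVT_min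
      (f := fun ka => dot (A ka e) (A ka e)) (ex_intro _ _ Ke) cK.
    apply: continuous_in_subspaceT => ka /set_mem Kka.
    have ce : {for ka, continuous (fun=> e)} by exact: cst_continuous.
    have := cA _ fst snd (fun=> e) ka (for_continuous_fst (x := ka))
      (for_continuous_snd (x := ka)) ce.
    rewrite -surjective_pairing => /(_ Kka Ne) cAe.
    exact: (for_continuous_comp cAe (sq_continuous (x := _))).
  by exists ka => // ka' Kka'; apply: kamin; exact: mem_set.
have [k1 k2] : ball a0 rho ka.1 /\ ball a1 rho ka.2.
  have nD : ~ D ka by move=> /DP; rewrite /P ltNge kamin.
  rewrite -!ball_normE; split; rewrite /= ltNge; apply/negP => h; apply: nD.
    by split=> //; left.
  by split=> //; right.
have B1 := KF ka e Kka Ne; have B2 := KG ka Kka.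
pose z := thF (ka.1, (psiF (p e)).2); pose z' := thG (ka.2, b1).
have NFz : NF z := box_img boxF B1; have NGz' : NG z' := box_img boxG B2.
have [Wz _ W1z _] := NFW _ NFz; have [_ _ W1z' _] := NGW _ NGz'.
suff /(A0 ka e Kka Ne) zz' : A ka e = 0.
  by exists z => //; split; [exact: leafF|rewrite /z zz'; exact: leafG].
have nball n (a v : 'rV[R]_n) : ball a rho v -> nbhs v (ball a rho).
  by move=> av; apply: open_nbhs_nbhs; split=> //; exact: ball_open.
(* Varying the first coordinate gives orthogonality to [EF] at [p z]; varying the second, after a
   change of sign, gives orthogonality to [EG] at [p z']. *)
apply: (tr (p z) (p z')) => // x.
- rewrite /A -/z -/z' /z (box_projE boxF B1); move: x.
  apply: (plaque_critical FEF FpsiF); apply: filterS (nball _ _ _ k1) => a a'B.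
  have Ka : K (a, ka.2) by apply: Kr.
  have B' := KF (a, ka.2) e Ka Ne.
  split.
  + by rewrite -(fcharts_cube FpsiF); exact: (box_cimg boxF B').
  + by rewrite -(box_projE boxF B'); exact/domF/(box_img boxF B').
  + have := kamin _ Ka; rewrite /A (box_projE boxF B') (box_projE boxF B1).
    exact.
- rewrite -[A ka e]opprK dotN => xE; apply/eqP; rewrite oppr_eq0; apply/eqP.
  move: x xE; rewrite /A opprB -/z -/z' /z' (box_projE boxG B2).
  apply: (plaque_critical GEG GpsiG); apply: filterS (nball _ _ _ k2) => a a'B.
  have Ka : K (ka.1, a) by apply: Kr.
  have B' := KG (ka.1, a) Ka.
  split.
  + by rewrite -(fcharts_cube GpsiG); exact: (box_cimg boxG B').
  + by rewrite -(box_projE boxG B'); exact/domG/(box_img boxG B').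
  + have := kamin _ Ka; rewrite -sqN -[leRHS]sqN /A !opprB.
    rewrite (box_projE boxG B') (box_projE boxG B2).
    exact.
Qed.

End LocalProduct.

(** * Inclusion of leaves for nested tangent bundles *)

Section LeafInclusion.
Context {R : realType} {d : nat} {M : manifold R d} {k q k' q' : nat}.
Variables (F : foliation R k q M) (F' : foliation R k' q' M).
Variables (E E' : M -> {vspace 'rV[R]_d}).
Hypothesis FE : tangent_foliation F E.
Hypothesis FE' : uniquely_integrates F' E'.
Hypothesis EE' : forall x, (E x <= E' x)%VS.

Lemma plaque_tangent_curve psi (a u : 'rV[R]_k) b (s t : R) : fcharts F psi ->
  (forall x, s < x < t -> ball 0 1 (a + x *: u, b)) ->
  tangent_curve E' s t (fun x => cinv psi (a + x *: u, b)).
Proof.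
move=> Fpsi B x xst; have Bx := B x xst.
pose z := cinv psi (a + x *: u, b).
have [[U [oU Ux] [Ud Uc]] _ rg] := FE Fpsi Bx; rewrite -/z in Ud Uc rg.
set P := (fun a' : 'rV[R]_k => chart z (cinv psi (a', b))) in Ud Uc rg.
have nU (y : R) : U (a + y *: u) -> \forall y' \near y, U (a + y' *: u).
  move=> Uy; have nUy : nbhs (a + y *: u) U by apply: open_nbhs_nbhs.
  exact: (for_continuous_nbhs (line_continuous (a := a) (u := u) (t := y)) nUy).
have dP y : U (a + y *: u) -> forall v,
    is_derive y v (fun y : R => P (a + y *: u)) ('D_(v *: u) P (a + y *: u)).
  move=> Uy v; have d1 := line_is_diff a u y.
  have d2 : is_diff (a + y *: u) P ('d P (a + y *: u)) by exact/differentiableP/Ud.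
  have [d3 d3E] := is_diff_comp d1 d2.
  split; first exact: diff_derivable.
  by rewrite deriveE// d3E /= deriveE//; exact: Ud.
split.
- apply: (@for_continuous_comp _ _ _ (fun x : R => (a + x *: u, b)) (cinv psi)).
    by apply: for_continuous_pair; [exact: line_continuous|exact: cst_continuous].
  by apply: cinv_continuous; rewrite (fcharts_cube Fpsi).
- exists [set y : R | U (a + y *: u)].
    by split=> //; rewrite openE => y; exact: nU.
  split=> [y Uy|v y Uy].
    apply: (differentiable_comp (f := fun y : R => a + y *: u) (g := P)).
      by have [] := line_is_diff a u y.
    exact: Ud.
  apply: (@continuous_eq_near _ _ (fun y : R => 'D_(v *: u) P (a + y *: u))).
    by apply: filterS (nU _ Uy) => y' Uy'; have [_ <-] := dP y' Uy' v.
  exact: (for_continuous_comp (line_continuous (a := a) (u := u) (t := y)) (Uc _ _ Uy)).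
- have [_ ->] := dP x Ux 1; rewrite scale1r.
  apply: (subvP (EE' z)).
  have : range ('d P (a + x *: u)) ('d P (a + x *: u) u) by exists u.
  by rewrite rg deriveE//; exact: Ud.
Qed.

(** The segment from [a] to [a'] in the convex cube gives a curve tangent to [E']. Tangent curves
    live on open intervals, so the segment is first prolonged slightly beyond both ends. *)
Lemma plaque_in_leaf psi (a a' : 'rV[R]_k) b : fcharts F psi ->
  ball 0 1 (a, b) -> ball 0 1 (a', b) -> leaf F' (cinv psi (a, b)) (cinv psi (a', b)).
Proof.
move=> Fpsi [aB bB] [a'B _]; pose u := a' - a.
have near_line (t : R) : ball 0 1 (a + t *: u) -> exists2 e : R, 0 < e &
    forall s, `|t - s| < e -> ball 0 1 (a + s *: u).
  move=> tB; have nB : nbhs (a + t *: u) (ball 0 1).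
    by apply: open_nbhs_nbhs; split=> //; exact: ball_open.
  have /nbhs_ballP[e /= e0 eB] :=
    for_continuous_nbhs (line_continuous (a := a) (u := u) (t := t)) nB.
  by exists e => // s ts; apply: eB; rewrite -ball_normE.
have l0 : a + 0 *: u = a by rewrite scale0r addr0.
have l1 : a + 1 *: u = a' by rewrite scale1r addrC subrK.
have [|e0 e00 e0B] := near_line 0; first by rewrite l0.
have [|e1 e10 e1B] := near_line 1; first by rewrite l1.
have [_ h] := FE'.
have c : tangent_curve E' (- e0) (1 + e1) (fun x => cinv psi (a + x *: u, b)).
  apply: plaque_tangent_curve => // x /andP[x0 x1]; split=> //=.
  have [xl|xg] := ltP x 0; first by apply: e0B; rewrite sub0r normrN ltr0_norm//; lra.
  have [xg1|xl1] := ltP 1 x.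
    by apply: e1B; rewrite ltr0_norm ?subr_lt0//; lra.
  have -> : a + x *: u = (1 - x) *: a + x *: a'.
    by rewrite /u scalerBr scalerBl scale1r -addrA [- _ + _]addrC.
  by apply: ball_segment => //; rewrite xg.
by have := h _ _ _ c 0 1; rewrite l0 l1; apply; lra.
Qed.

(** Plaques of [F] lie in leaves of [F'], so the path stays in one leaf of [F'];
    [path_in_leaf_leafwise] then gives continuity for its leaf topology. *)
Lemma leafwise_inclusion (c : R -> M) :
  continuous (c : R -> leaf_space F) -> continuous (c : R -> leaf_space F').
Proof.
move=> cc; apply: (path_in_leaf_leafwise (x0 := c 0) (msecond_countable M)).
  by move=> t; exact: leaf_continuous_continuous (cc t).
move=> t; apply: (@locally_constant _ (fun t => leaf F' (c 0) (c t)) _ 0) => [{}t|].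
  have [psi Fpsi [psit near_t]] := leaf_continuous_plaque (cc t).
  apply: filterS near_t => s [psis e].
  have st : leaf F' (c s) (c t).
    rewrite -(cmapK psis) -(cmapK psit) (surjective_pairing (psi (c s))).
    rewrite (surjective_pairing (psi (c t))) e.
    apply: plaque_in_leaf => //; last first.
      by rewrite -surjective_pairing -(fcharts_cube Fpsi); exact: cmap_img.
    by rewrite -e -surjective_pairing -(fcharts_cube Fpsi); exact: cmap_img.
  by split=> h; apply: leaf_trans h _ => //; exact: leaf_sym.
exact: leaf_refl.
Qed.

Lemma lifted_leaf_inclusion (Y : topologicalType) (p : Y -> M) x y :
  lifted_leaf F p x y -> lifted_leaf F' p x y.
Proof.
move=> /lifted_leaf_exists[c [cc pc <- <-]].
exact: (lifted_leaf_path cc (leafwise_inclusion pc)).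
Qed.

End LeafInclusion.

(** * Intersections of complementary leaves *)

Section GlobalProduct.
Context {R : realType} {k q l r : nat} {Y X : topologicalType}.
Variables (F : foliation R k q X) (G : foliation R l r X) (p : Y -> X).
Hypothesis pcov : covering_map p.

Definition local_product_structure := forall w W, nbhs w W ->
  \forall e \near w, exists2 z, W z & lifted_leaf F p e z /\ lifted_leaf G p w z.

Hypothesis lps : local_product_structure.

(** Transport along [F] from [z] to [w] brings points near [z] close to [w], where the local product
    structure applies. *)
Lemma meet_continuous y z w (W : set Y) : nbhs w W ->
  lifted_leaf F p z w -> lifted_leaf G p y w ->
  \forall z' \near z, exists2 w', W w' &
    lifted_leaf F p z' w' /\ lifted_leaf G p y w'.
Proof.
move=> nW zw yw; have [U [H trH [Uz Hz]]] := transport_exists pcov zw.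
have := lps nW; rewrite -{1}Hz.
have nU : nbhs z U by apply: open_nbhs_nbhs; split=> //; exact: (transport_open trH).
move=> /(for_continuous_nbhs (transport_continuous1 (t := 1) trH Uz)).
apply: filterS2 nU => z' Uz' [w' Ww' [w'1 w'2]]; exists w' => //; split.
  exact: lifted_leaf_trans (transport_lifted_leaf trH Uz') w'1.
exact: lifted_leaf_trans yw w'2.
Qed.

(* The leaf of F through z is determined by its intersection with a fixed leaf of G,
   which depends continuously on z. *)
Lemma leaf_relation_closed : hausdorff_space Y ->
  (forall x y, meet_once (lifted_leaf G p x) (lifted_leaf F p y)) ->
  forall y y', ~ lifted_leaf F p y y' -> exists A B, [/\ nbhs y A, nbhs y' B &
    forall s s', A s -> B s' -> ~ lifted_leaf F p s s'].
Proof.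
move=> hY meet y y' nyy'.
have [w' [[yw' y'w'] _]] := meet y y'.
have yw : y <> w' by move=> e; apply: nyy'; rewrite {1}e; exact: lifted_leaf_sym.
have [A [B [nA nB AB]]] := hausdorff_near hY yw.
have nA' := meet_continuous nA (lifted_leaf_refl F p y) (lifted_leaf_refl G p y).
have nB' := meet_continuous nB y'w' yw'.
pose S C := [set z | exists2 w, C w & lifted_leaf F p z w /\ lifted_leaf G p y w].
exists (S A), (S B); split; [exact: nA'|exact: nB'|].
move=> s s' [v Av [sv yv]] [v' Bv' [s'v' yv']] ss'.
have [v0 [_ v0u]] := meet y s.
have : (A `&` B) v; last by rewrite AB.
split=> //; rewrite -(v0u v)// (v0u v')//; split=> //.
exact: lifted_leaf_trans ss' s'v'.
Qed.

End GlobalProduct.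

(** * Holonomy *)

Section Holonomy.
Context {R : realType} {k q : nat} {Y X : topologicalType}.
Variables (C : foliation R k q X) (p : Y -> X).
Hypothesis pcov : covering_map p.

Lemma slice_small_transversal psi x : fcharts C psi -> cdom psi x ->
  small_transversal C x [set y | cdom psi y /\ (psi y).1 = (psi x).1].
Proof.
move=> Cpsi psix; set a := (psi x).1; split=> //; exists psi => //.
split=> [y []//|].
have Bcube b : ball (0 : 'rV[R]_q) 1 b -> cimg psi (a, b).
  rewrite (fcharts_cube Cpsi) => bB; split => //=.
  by have := cmap_img psix; rewrite (fcharts_cube Cpsi) => -[].
exists (ball 0 1), (fun b => cinv psi (a, b)); split; first exact: ball_open.
split.
- apply: continuous_in_subspaceT => y /set_mem[yD _].
  exact: (for_continuous_comp (cmap_continuous yD) (for_continuous_snd (x := _))).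
- apply: continuous_in_subspaceT => b /set_mem bB.
  exact: (for_continuous_comp (for_continuous_pairr (x := a) (y := b))
    (cinv_continuous (Bcube b bB))).
- move=> _ [y [yD _] <-]; have := cmap_img yD.
  by rewrite (fcharts_cube Cpsi) => -[].
- move=> _ [b bB <-]; have bI := Bcube b bB; split; first exact: cinv_dom.
  by rewrite cinvK.
- split=> [y [yD ya]|b bB]; last by rewrite cinvK//; exact: Bcube.
  by rewrite -ya -surjective_pairing cmapK.
Qed.

Hypothesis wh : without_holonomy C.

(* z and z' are two lifts of the same point, in the same leaf; a leafwise path from
   z to z' projects to a loop, the holonomy of which is trivial. *)
Lemma leaf_pair_open z z' : p z = p z' -> lifted_leaf C p z z' ->
  exists A B, [/\ nbhs z A, nbhs z' B &
    forall y y', A y -> B y' -> p y = p y' -> lifted_leaf C p y y'].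
Proof.
move=> zz' lzz'; pose x := p z.
have [psi Cpsi psix] := fcharts_cover C x.
have psix' : cdom psi (p z') by rewrite -zz'.
have [U [oU Ux] /(_ z Ux)[V [g [oV Vz Vg Ug _]]]] := evenly_covered pcov x.
have [V' nV' V'inj] := locally_injective pcov z'.
have nV : nbhs z V by apply: open_nbhs_nbhs.
have [e [N [th box NV]]] := flowbox_exists pcov psix nV.
have [e' [N' [th' box' N'V']]] := flowbox_exists pcov psix' nV'.
have Nz := box_center box; have Nz' := box_center box'.
pose a := (psi x).1.
have aB : ball (psi (p z)).1 e a by apply: ballxx; exact: (box_gt0 box).
have aB' : ball (psi (p z')).1 e' a.
  by rewrite -zz'; apply: ballxx; exact: (box_gt0 box').
(* Holonomy is defined on a transversal, so points near [z] and [z'] are first slid to the slice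
   [tau] of first coordinate [a]. *)
have [S trS S1] := slide pcov Cpsi box aB.
have [S' trS' S'1] := slide pcov Cpsi box' aB'.
have [U0 [H0 trH0 [U0z H0z]]] := transport_exists pcov lzz'.
(* [K] follows [H0] into the box of [z'] and then slides to the slice, so that its projected paths
   end in [tau]. *)
have trK := transport_concat trH0 trS'.
set U1 := [set y | _] in trK; set K := concat H0 _ in trK.
have U1z : U1 z by split=> //; rewrite H0z.
have K1 y : K (y, 1) = S' (H0 (y, 1), 1) by rewrite /K concat1.
have NK y : U1 y -> N' (K (y, 1)).
  by move=> [_ Ny]; rewrite K1; have [_ /(_ 1)[]] := S'1 _ Ny.
have thS y : N y -> psi (p (S (y, 1))) = (a, (psi (p y)).2).
  move=> Ny; have [-> _] := S1 y Ny; rewrite (box_invK box)//.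
  by split=> //; have [] := box_ball box Ny.
have thS' y : N' y -> psi (p (S' (y, 1))) = (a, (psi (p y)).2).
  move=> Ny; have [-> _] := S'1 y Ny; rewrite (box_invK box')//.
  by split=> //; have [] := box_ball box' Ny.
have [_ gz] := Vg z Vz; have [_ _ cg] := Ug x Ux.
have Kz1 : K (z, 1) = z'.
  rewrite K1 H0z; have [-> _] := S'1 _ Nz'.
  by rewrite /a /x zz' -surjective_pairing (boxK box').
pose tau := [set y | cdom psi y /\ (psi y).1 = a].
have nU1 y : U1 y -> nbhs y U1.
  by move=> U1y; apply: open_nbhs_nbhs; split=> //; exact: (transport_open trK).
pose U' := [set m | U m /\ U1 (g m)].
have nU' : nbhs x U'.
  apply: filterI; first exact: open_nbhs_nbhs.
  by apply: (for_continuous_nbhs cg); rewrite gz; exact: nU1.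
(* Triviality of the holonomy: for [m] in [tau] close to [x], the transport [K] takes the lift [g m]
   to a point over the same [m]. *)
have near_x : \forall m \near x, tau m -> p (K (g m, 1)) = m.
  apply: (@wh x (fun t => p (K (z, t))) tau U' (fun m => p (K (g m, 1)))).
  - exact/continuous_subspaceT/(transport_leaf trK U1z).
  - by rewrite (transport0 trK U1z).
  - by rewrite Kz1.
  - exact: slice_small_transversal.
  - exact: nU'.
  exists (fun s => p (K (g s.1, s.2))); split.
  - apply: continuous_in_subspaceT => -[m t] /set_mem[/= [_ [Um U1m]] _].
    have [_ _ cgm] := Ug m Um.
    have cm := for_continuous_comp (for_continuous_fst (x := (m, t))) cgm.
    have cmt := for_continuous_pair cm (for_continuous_snd (x := (m, t))).
    have cK := for_continuous_comp cmt (transport_continuous trK U1m).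
    exact: (for_continuous_comp cK (covering_continuous pcov (x := _))).
  - by move=> t _; rewrite /= (transport0 trK U1z) gz.
  - move=> m [taum [Um U1m]]; split=> //=.
    + exact/continuous_subspaceT/(transport_leaf trK U1m).
    + by rewrite (transport0 trK U1m); have [] := Ug m Um.
    + split; first exact: (box_dom box' (NK _ U1m)).
      by have [_ Nm] := U1m; rewrite K1 thS'.
pose A1 := [set y | [/\ V y, U1 y & tau (p y) -> p (K (g (p y), 1)) = p y]].
have nA1 : nbhs z A1.
  have := for_continuous_nbhs (covering_continuous pcov (x := z)) near_x.
  by apply: filterS3 nV (nU1 _ U1z) => y Vy U1y h; split.
(* [K (y, 1)] and [y'] lie over the same point and in a set where [p] is injective, so they are
   equal. *)
have A1P y y' : A1 y -> tau (p y) -> N' y' -> p y = p y' -> lifted_leaf C p y y'.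
  move=> [Vy U1y /[apply] h] Ny' yy'; move: h; have [_ ->] := Vg y Vy => h.
  have <- : K (y, 1) = y'.
    by apply: V'inj; [exact/N'V'/NK|exact: N'V'|rewrite h].
  exact: (transport_lifted_leaf trK U1y).
exists [set y | N y /\ A1 (S (y, 1))], N'; split.
- apply: filterI; first exact: (box_nbhs box).
  apply: (for_continuous_nbhs (transport_continuous1 (t := 1) trS Nz)).
  have [-> _] := S1 z Nz; have -> : (a, (psi (p z)).2) = psi (p z).
    by rewrite [RHS]surjective_pairing.
  by rewrite (boxK box).
- exact: (box_nbhs box').
- move=> y y' [Ny A1y] Ny' yy'.
  have NSy : N (S (y, 1)) by have [_ /(_ 1)[]] := S1 y Ny.
  have NSy' : N' (S' (y', 1)) by have [_ /(_ 1)[]] := S'1 y' Ny'.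
  have pSS' : p (S (y, 1)) = p (S' (y', 1)).
    rewrite -(cmapK (box_dom box NSy)) -(cmapK (box_dom box' NSy')).
    by rewrite thS// thS'// yy'.
  apply: lifted_leaf_trans (transport_lifted_leaf trS Ny) _.
  apply: lifted_leaf_trans (lifted_leaf_sym (transport_lifted_leaf trS' Ny')).
  apply: A1P => //; split; first exact: (box_dom box NSy).
  by rewrite thS.
Qed.

Lemma leaf_pair_transfer (c c' : R -> Y) :
  (forall y y', ~ lifted_leaf C p y y' -> exists A B, [/\ nbhs y A, nbhs y' B &
    forall s s', A s -> B s' -> ~ lifted_leaf C p s s']) ->
  continuous c -> continuous c' -> (forall t, 0 <= t <= 1 -> p (c t) = p (c' t)) ->
  lifted_leaf C p (c 0) (c' 0) -> lifted_leaf C p (c 1) (c' 1).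
Proof.
move=> Ccl cc cc' pcc'.
apply: (@locally_constant_segment _ (fun t => lifted_leaf C p (c t) (c' t))) => t t01.
have [h|h] := pselect (lifted_leaf C p (c t) (c' t)).
  have [A [B [nA nB AB]]] := leaf_pair_open (pcc' t t01) h.
  apply: filterS2 (for_continuous_nbhs (cc t) nA) (for_continuous_nbhs (cc' t) nB).
  by move=> s As Bs s01; split=> // _; apply: AB => //; exact: pcc'.
have [A [B [nA nB AB]]] := Ccl _ _ h.
apply: filterS2 (for_continuous_nbhs (cc t) nA) (for_continuous_nbhs (cc' t) nB).
by move=> s As Bs s01; split=> // /AB; case.
Qed.

End Holonomy.

(** * Homeomorphisms between leaves of [C] along the leaves of [F] *)

Section LeafHomeomorphism.
Context {R : realType} {kc qc kf qf kg qg : nat} {Y X : topologicalType}.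
Variables (C : foliation R kc qc X) (F : foliation R kf qf X).
Variables (G : foliation R kg qg X) (p : Y -> X).
Hypothesis X2 : @second_countable X.
Hypothesis pcov : covering_map p.
Hypothesis lps : local_product_structure F G p.
Hypothesis meetFG : forall x y, meet_once (lifted_leaf F p x) (lifted_leaf G p y).
Hypothesis CG : forall x y, lifted_leaf C p x y -> lifted_leaf G p x y.
Hypothesis FC : forall x y z, lifted_leaf F p x y -> lifted_leaf C p x z ->
  exists w, lifted_leaf C p y w /\ lifted_leaf F p z w.
Hypothesis transfer : forall c c' : R -> Y, continuous c -> continuous c' ->
  (forall t, 0 <= t <= 1 -> p (c t) = p (c' t)) ->
  lifted_leaf C p (c 0) (c' 0) -> lifted_leaf C p (c 1) (c' 1).

(** Projection of all of [Y] to the [G] leaf of [y] along [F]. By [hol_leaf] it sends the [C] leaf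
    of any point of the [F] leaf of [y] into the [C] leaf of [y]. *)
Definition hol (y z : Y) : Y := sval (cid (meetFG z y)).

Lemma holP y z : lifted_leaf F p z (hol y z) /\ lifted_leaf G p y (hol y z).
Proof. by have [] := svalP (cid (meetFG z y)). Qed.

Lemma hol_unique y z w : lifted_leaf F p z w -> lifted_leaf G p y w -> hol y z = w.
Proof. by move=> zw yw; have [_] := svalP (cid (meetFG z y)); apply. Qed.

Lemma hol_leaf x y z : lifted_leaf F p x y -> lifted_leaf C p x z ->
  lifted_leaf C p y (hol y z).
Proof.
move=> xy xz; have [w [yw zw]] := FC xy xz.
by rewrite (hol_unique zw (CG yw)).
Qed.

Lemma hol_continuous y : continuous (hol y).
Proof.
move=> z; apply: nbhs_for_continuous => W nW; have [zw yw] := holP y z.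
apply: filterS (meet_continuous pcov lps nW zw yw) => z' [w' Ww' [zw' yw']].
by rewrite (hol_unique zw' yw').
Qed.

Lemma holK x y z : lifted_leaf F p x y -> lifted_leaf C p x z ->
  hol x (hol y z) = z.
Proof.
move=> xy xz; apply: hol_unique; last exact: CG.
by apply: lifted_leaf_sym; have [] := holP y z.
Qed.

Lemma hol_proj x y z z' : lifted_leaf F p x y -> lifted_leaf C p x z ->
  lifted_leaf C p x z' -> p z = p z' -> p (hol y z) = p (hol y z').
Proof.
move=> xy xz xz' zz'; have [zw _] := holP y z.
have [c [cc pc c0 c1]] := lifted_leaf_exists zw.
have [|c' [cc' c'0 pc' z'w']] := leafwise_path_lifting pcov (x := z') pc.
  by rewrite /= c0.
have h : lifted_leaf C p (c 0) (c' 0).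
  by rewrite c0 c'0; exact: lifted_leaf_trans (lifted_leaf_sym xz) xz'.
have {}h := transfer cc cc' (fun t t01 => esym (pc' t t01)) h.
rewrite c1 in h; rewrite -c1 -[p (c 1)](pc' 1) ?ler01 ?lexx//; congr p; apply/esym.
apply: hol_unique => //; apply: CG.
exact: lifted_leaf_trans (hol_leaf xy xz) h.
Qed.

(** An arbitrary choice of lift, with no continuity in [m]; [hol_proj] makes [leaf_map] independent
    of it. Outside the leaf, [x] is a default value. *)
Definition lift_in_leaf (x : Y) (m : X) : Y :=
  if pselect (leaf C (p x) m) is left h then
    let (z, _, _) := cid2 (leaf_lift pcov h) in z else x.

Lemma lift_in_leafP x m : leaf C (p x) m ->
  lifted_leaf C p x (lift_in_leaf x m) /\ p (lift_in_leaf x m) = m.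
Proof. by rewrite /lift_in_leaf; case: pselect => // h _; case: cid2. Qed.

Definition leaf_map (x y : Y) (m : X) : X := p (hol y (lift_in_leaf x m)).

Lemma leaf_mapE x y z : lifted_leaf F p x y -> lifted_leaf C p x z ->
  leaf_map x y (p z) = p (hol y z).
Proof.
move=> xy xz; have [h e] := lift_in_leafP (lifted_leaf_proj xz).
exact: hol_proj xy h xz e.
Qed.

(** Near a point, the chosen lifts may be replaced by the continuous lift [th] of a flow box, so
    continuity in [X] follows from that of [hol]. For the leaf topology, a path inside a plaque has
    an image contained in one leaf and one chart; it is thus leafwise, and its transverse coordinate
    is constant. *)
Lemma leaf_map_continuous x y : lifted_leaf F p x y ->
  {within (leaf C (p x) : set (leaf_space C)),
    continuous (leaf_map x y : leaf_space C -> leaf_space C)}.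
Proof.
move=> xy; apply: continuous_in_subspaceT => m /set_mem xm.
have [xz zm] := lift_in_leafP xm; set z := lift_in_leaf x m in xz zm.
apply: nbhs_for_continuous => A; rewrite -zm (leaf_mapE xy xz).
set n := p (hol y z) => nA.
have [psi' Cpsi' psi'n] := fcharts_cover C n.
have [psi Cpsi psim] := fcharts_cover C (p z).
have nN : nbhs n [set v | cdom psi' v /\ ((psi' v).2 = (psi' n).2 -> A v)].
  exact: (filterI (cdom_nbhs psi'n) (leaf_nbhs_plaque nA Cpsi' psi'n)).
have nW := for_continuous_nbhs (for_continuous_comp
  (hol_continuous (y := y) (x := z)) (covering_continuous pcov (x := hol y z))) nN.
have [e [N [th box NW]]] := flowbox_exists pcov psim nW.
have nB : nbhs (psi (p z)) (ball (psi (p z)) e).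
  by apply: nbhsx_ballx; exact: (box_gt0 box).
apply: (plaque_leaf_nbhs Cpsi psim).
apply: filterS2 (cdom_nbhs psim) (for_continuous_nbhs (cmap_continuous psim) nB).
move=> m' m'D m'B m'm.
pose z' := th (psi m'); have Nz' : N z' := box_img box m'B.
have pz' : p z' = m' by rewrite (box_projE box m'B) cmapK.
have Nz := box_center box.
have zz' : (psi (p z)).2 = (psi (p z')).2 by rewrite pz' m'm.
have xz' : lifted_leaf C p x z'.
  exact: lifted_leaf_trans xz (box_lifted_leaf pcov Cpsi box Nz Nz' zz').
rewrite -pz' (leaf_mapE xy xz').
have [S trS [Sz' SN]] := box_transport pcov Cpsi box Nz Nz' zz'.
pose c t := p (hol y (S (z, t))).
have cD t : cdom psi' (c t) by have [/NW[]] := SN t.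
have xS t : lifted_leaf C p x (S (z, t)).
  have [NSt St] := SN t.
  by apply: lifted_leaf_trans xz (box_lifted_leaf pcov Cpsi box Nz NSt _).
have cc : continuous c.
  move=> t; have cS : {for t, continuous (fun t => S (z, t))}.
    exact: (transport_continuous2 trS Nz).
  have ch := for_continuous_comp cS (hol_continuous (y := y) (x := S (z, t))).
  exact: (for_continuous_comp ch (covering_continuous pcov (x := _))).
have lc : continuous (c : R -> leaf_space C).
  apply: (path_in_leaf_leafwise X2 (x0 := p y) cc) => t.
  exact/lifted_leaf_proj/(hol_leaf xy).
suff c1 : (psi' (c 1)).2 = (psi' n).2.
  have [/NW[_ h] _] := SN 1; rewrite -Sz'; exact: h.
apply: (@locally_constant _ (fun t => (psi' (c t)).2 = (psi' n).2) _ 0) => [t|].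
  have [_ near_t] := (leaf_continuousP Cpsi' (cD t)).1 (lc t).
  by apply: filterS near_t => s ->.
by rewrite /c (transport0 trS Nz).
Qed.

Lemma leaf_homeomorphism x y : lifted_leaf F p x y ->
  homeomorphic_leaves C (p x) (p y).
Proof.
move=> xy; have yx := lifted_leaf_sym xy.
have into u v (uv : lifted_leaf F p u v) m : leaf C (p u) m ->
    leaf C (p v) (leaf_map u v m) /\ leaf_map v u (leaf_map u v m) = m.
  move=> um; have [uz <-] := lift_in_leafP um; rewrite (leaf_mapE uv uz).
  have vh := hol_leaf uv uz; split; first exact: lifted_leaf_proj.
  by rewrite (leaf_mapE (lifted_leaf_sym uv) vh) (holK uv uz).
exists (leaf_map x y), (leaf_map y x); split.
- exact: leaf_map_continuous.
- exact: leaf_map_continuous.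
- by move=> _ [m xm <-]; have [] := into _ _ xy m xm.
- by move=> _ [m ym <-]; have [] := into _ _ yx m ym.
- split=> m; first by move=> /(into _ _ xy)[].
  by move=> /(into _ _ yx)[].
Qed.

End LeafHomeomorphism.

(** * Composition of homeomorphisms between leaves *)

Section HomeomorphicLeaves.
Context {R : realType} {k q : nat} {X : topologicalType}.
Variable F : foliation R k q X.

Lemma homeomorphic_leaves_eq x y : leaf F x y -> homeomorphic_leaves F x y.
Proof.
move=> xy; have xyE : leaf F x = leaf F y.
  by apply/seteqP; split=> z; apply: leaf_trans => //; exact: leaf_sym.
rewrite /homeomorphic_leaves -xyE.
have cid : {within (leaf F x : set (leaf_space F)),
    continuous (id : leaf_space F -> leaf_space F)}.
  by apply: continuous_subspaceT => z; exact: cvg_id.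
by exists id, id; split=> // _ [z xz <-].
Qed.

Lemma within_continuous_comp (T U V : topologicalType) (A : set T) (B : set U)
    (f : T -> U) (g : U -> V) : {within A, continuous f} ->
  {within B, continuous g} -> f @` A `<=` B -> {within A, continuous (g \o f)}.
Proof.
move=> /subspace_continuousP cf /subspace_continuousP cg fAB.
apply/subspace_continuousP => x Ax W nW.
have := cf x Ax _ (cg (f x) (fAB _ (imageP f Ax)) W nW).
rewrite !nbhs_simpl /= /within /=; apply: filterS => y h Ay.
by apply: h => //; apply: fAB; exists y.
Qed.

Lemma homeomorphic_leaves_trans x y z : homeomorphic_leaves F x y ->
  homeomorphic_leaves F y z -> homeomorphic_leaves F x z.
Proof.
move=> [h [g [ch cg hxy gyx [gK hK]]]] [h' [g' [ch' cg' hyz gzy [gK' hK']]]].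
exists (h' \o h), (g \o g'); split.
- exact: within_continuous_comp ch ch' hxy.
- exact: within_continuous_comp cg' cg gzy.
- by move=> _ [a xa <-]; apply: hyz; exists (h a) => //; apply: hxy; exists a.
- by move=> _ [a za <-]; apply: gyx; exists (g' a) => //; apply: gzy; exists a.
- split=> a ha /=.
    by rewrite gK' ?gK//; apply: hxy; exists a.
  by rewrite hK ?hK'//; apply: gzy; exists a.
Qed.

End HomeomorphicLeaves.

(** * Center leaves under global product structure *)

Unset Implicit Arguments.

Theorem theorem1p7 (R : realType) (d s c u : nat)
  (M : manifold R d) (g : riemannian M) (f : M -> M)
  (Es Ec Eu : M -> {vspace 'rV[R]_d})
  (Ws : foliation R s (c + u) M) (Wc : foliation R c (s + u) M)
  (Wu : foliation R u (c + s) M)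
  (Wcs : foliation R (c + s) u M) (Wcu : foliation R (c + u) s M)
  (Mt : topologicalType) (p : Mt -> M) :
  compact [set: M] -> connected [set: M] ->
  partially_hyperbolic g f s c u Es Ec Eu ->
  tangent_foliation Ws Es -> tangent_foliation Wu Eu ->
  universal_cover R p ->
  global_product_structure Es Ec Eu Ws Wc Wu Wcs Wcu p ->
  without_holonomy Wc ->
  forall x y : M, homeomorphic_leaves Wc x y.
Proof.
move=> _ _ ph sWs sWu [pcov _] [[uWc uWcs uWcu] gps] wh x y.
have [_ [bs bc bu EE] _ _ _] := ph.
have hMt : hausdorff_space Mt := covering_hausdorff pcov (@mhausdorff _ _ M).
have c_cs a b : lifted_leaf Wc p a b -> lifted_leaf Wcs p a b.
  by apply: (lifted_leaf_inclusion uWc.1 uWcs) => z; exact: addvSl.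
have c_cu a b : lifted_leaf Wc p a b -> lifted_leaf Wcu p a b.
  by apply: (lifted_leaf_inclusion uWc.1 uWcu) => z; exact: addvSl.
have s_cs a b : lifted_leaf Ws p a b -> lifted_leaf Wcs p a b.
  by apply: (lifted_leaf_inclusion sWs uWcs) => z; exact: addvSr.
have u_cu a b : lifted_leaf Wu p a b -> lifted_leaf Wcu p a b.
  by apply: (lifted_leaf_inclusion sWu uWcu) => z; exact: addvSr.
have meet_sym T (A B : set T) : meet_once A B -> meet_once B A.
  by rewrite /meet_once setIC.
have meet_u_cs a b : meet_once (lifted_leaf Wu p a) (lifted_leaf Wcs p b).
  by have [] := gps a b.
have meet_s_cu a b : meet_once (lifted_leaf Ws p a) (lifted_leaf Wcu p b).
  by have [] := gps a b.
(* Complementary leaves through [w] meet only at [w], as [local_product] requires. *)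
have uniq k q (F : foliation R k q M) k' q' (G : foliation R k' q' M) w z :
    meet_once (lifted_leaf F p w) (lifted_leaf G p w) ->
    lifted_leaf F p w z -> lifted_leaf G p w z -> z = w.
  move=> [v [_ vu]] wz wz'; rewrite -(vu z)//; apply: vu.
  by split; exact: lifted_leaf_refl.
have secs w := continuous_subbundle_sections (w := w) bs.
have secc w := continuous_subbundle_sections (w := w) bc.
have secu w := continuous_subbundle_sections (w := w) bu.
have full_s_cu w : (Es w + (Ec w + Eu w))%VS = fullv by rewrite addvA; have [] := EE w.
have full_u_cs w : (Eu w + (Ec w + Es w))%VS = fullv.
  by rewrite addvC [(Ec w + Es w)%VS]addvC; have [] := EE w.
have lps_s_cu : local_product_structure Ws Wcu p.
  move=> w W nW; apply: (local_product sWs uWcu.1 pcov nW) => //.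
  - exact: has_sectionsD.
  - by move=> z; exact: uniq.
have lps_cu_s : local_product_structure Wcu Ws p.
  move=> w W nW; apply: (local_product uWcu.1 sWs pcov nW) => //.
  - exact: has_sectionsD.
  - by rewrite addvC.
  - by move=> z; apply: uniq; exact: meet_sym.
have lps_u_cs : local_product_structure Wu Wcs p.
  move=> w W nW; apply: (local_product sWu uWcs.1 pcov nW) => //.
  - exact: has_sectionsD.
  - by move=> z; exact: uniq.
have lps_cs_u : local_product_structure Wcs Wu p.
  move=> w W nW; apply: (local_product uWcs.1 sWu pcov nW) => //.
  - exact: has_sectionsD.
  - by rewrite addvC.
  - by move=> z; apply: uniq; exact: meet_sym.
(* The center leaf of [a] meets the stable leaf of [b] at some [z]. Both [z] and [b] lie in this
   stable leaf and in the center unstable leaf of [a], which meet only once. *)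
have c_meet a b : lifted_leaf Wcs p a b -> lifted_leaf Wcu p a b -> lifted_leaf Wc p a b.
  move=> csab cuab; have [_ _ /(_ (lifted_leaf_sym csab))[z [[az bz] _]] _] := gps a b.
  have [v [_ vu]] := meet_s_cu b a.
  have zb : z = b.
    rewrite -(vu z) ?(vu b)//; first by split=> //; exact: lifted_leaf_refl.
    by split=> //; exact: c_cu.
  by rewrite -zb.
have c_closed a b : ~ lifted_leaf Wc p a b -> exists A B, [/\ nbhs a A, nbhs b B &
    forall s s', A s -> B s' -> ~ lifted_leaf Wc p s s'].
  move=> nab; have [csab|ncs] := pselect (lifted_leaf Wcs p a b).
    have ncu : ~ lifted_leaf Wcu p a b by move=> cuab; apply: nab; exact: c_meet.
    have [A [B [nA nB AB]]] := leaf_relation_closed pcov lps_cu_s hMt meet_s_cu ncu.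
    by exists A, B; split=> // v v' Av Bv' /c_cu; exact: AB.
  have [A [B [nA nB AB]]] := leaf_relation_closed pcov lps_cs_u hMt meet_u_cs ncs.
  by exists A, B; split=> // v v' Av Bv' /c_cs; exact: AB.
have transfer c1 c2 := leaf_pair_transfer pcov wh (c := c1) (c' := c2) c_closed.
have M2 := msecond_countable M.
have homeo_s a b : lifted_leaf Ws p a b -> homeomorphic_leaves Wc (p a) (p b).
  apply: (leaf_homeomorphism M2 pcov lps_s_cu meet_s_cu c_cu _ transfer).
  (* Since [z] and [b'] share a center stable leaf, the center leaf of [b'] meets the stable leaf of
     [z]. *)
  move=> a' b' z ab az; have zb : lifted_leaf Wcs p z b'.
    exact: lifted_leaf_trans (lifted_leaf_sym (c_cs _ _ az)) (s_cs _ _ ab).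
  by have [_ _ /(_ zb)[w [[bw zw] _]] _] := gps b' z; exists w.
have homeo_u a b : lifted_leaf Wu p a b -> homeomorphic_leaves Wc (p a) (p b).
  apply: (leaf_homeomorphism M2 pcov lps_u_cs meet_u_cs c_cs _ transfer).
  move=> a' b' z ab az; have zb : lifted_leaf Wcu p z b'.
    exact: lifted_leaf_trans (lifted_leaf_sym (c_cu _ _ az)) (u_cu _ _ ab).
  by have [_ _ _ /(_ zb)[w [[bw zw] _]]] := gps b' z; exists w.
have [a <-] := covering_surj pcov x; have [b <-] := covering_surj pcov y.
(* An unstable move from [a] to [v], a center move from [v] to [w] and a stable move from [w] to [b]
   relate any two center leaves. *)
have [v [[av bv] _]] := meet_u_cs a b.
have [_ _ /(_ bv)[w [[vw bw] _]] _] := gps v b.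
apply: homeomorphic_leaves_trans (homeo_u _ _ av) _.
apply: homeomorphic_leaves_trans (homeo_s _ _ (lifted_leaf_sym bw)).
exact/homeomorphic_leaves_eq/lifted_leaf_proj.
Qed.
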